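(* Let $v>0$, $w>0$ be real with $v/w\in\overline{\mathbb{Q}}\setminus\mathbb{Q}$, and let $\alpha=v(1-y_1)+w(1-y_2)$ with $0\le y_1,y_2<1$. Then the following are equivalent: (a) for every $\varepsilon>0$, $\zeta_2(\sigma+it,\alpha;v,w)=O(t^{\varepsilon})$ for $\tfrac12\le\sigma\le2$; (b) for every $k\in\mathbb{N}$ and every $\varepsilon>0$, $\int_2^T|\zeta_2(\sigma+it,\alpha;v,w)|^{2k}\,dt=O(T^{1+\varepsilon})$ for $\tfrac12\le\sigma\le 2$. Here the $O$-constants depend only on $\varepsilon$ and $k$.
   Context: The Barnes double zeta-function is $\zeta_2(s,\alpha;v,w)=\sum_{m=0}^\infty\sum_{n=0}^\infty(\alpha+vm+wn)^{-s}$, absolutely convergent for $\mathrm{Re}(s)>2$ and continued meromorphically to $\mathbb{C}$. $\overline{\mathbb{Q}}$ denotes the algebraic numbers. *)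

(* Defs.v *)
(* Real numbers are those of Stdlib; complex numbers and analysis are those of
   Coquelicot. *)
From Stdlib Require Import Reals QArith Qreals.
From Coquelicot Require Import Coquelicot.
Open Scope R_scope.

Definition irrational (x : R) : Prop := forall q : Q, x <> Q2R q.

Definition algebraic (x : R) : Prop :=
  exists (a : nat -> Z) (d : nat),
    a d <> 0%Z /\ sum_f_R0 (fun i => IZR (a i) * x ^ i) d = 0.

Definition Cexp (z : C) : C :=
  (exp (Re z) * cos (Im z), exp (Re z) * sin (Im z)).

(* Meaningful for x > 0 only, with the real logarithm of x. *)
Definition RCpow (x : R) (s : C) : C := Cexp (s * RtoC (ln x))%C.

Definition holomorphic_at (f : C -> C) (z0 : C) : Prop :=
  locally (T := C_UniformSpace) z0
    (ex_derive (K := C_AbsRing) (V := C_NormedModule) f).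

Definition pole_at (f : C -> C) (z0 : C) : Prop :=
  exists (n : nat) (g : C -> C),
    (1 <= n)%nat /\ holomorphic_at g z0 /\ g z0 <> RtoC 0 /\
    locally' (T := C_UniformSpace) z0 (fun z => f z = (g z / (z - z0) ^ n)%C).

(* Functions are total: the value of a meromorphic function is arbitrary at its
   poles, and only there (removable singularities are excluded). *)
Definition meromorphic (f : C -> C) : Prop :=
  forall z0 : C, holomorphic_at f z0 \/ pole_at f z0.

(* Iterated sum, outer index m and inner index n; for an absolutely convergent family this is the
   sum of the double series. *)
Definition is_double_series (a : nat -> nat -> C) (l : C) : Prop :=
  exists r : nat -> C,
    (forall m : nat, is_series (K := C_AbsRing) (V := C_NormedModule) (a m) (r m)) /\
    is_series (K := C_AbsRing) (V := C_NormedModule) r l.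

(* Z is the Barnes double zeta-function s |-> zeta_2(s, alpha; v, w): the
   meromorphic continuation to C of the double series, unique off its poles. *)
Definition is_barnes_zeta2 (alpha v w : R) (Z : C -> C) : Prop :=
  meromorphic Z /\
  forall s : C, 2 < Re s ->
    is_double_series
      (fun m n => RCpow (alpha + v * INR m + w * INR n) (- s)%C) (Z s).

(* F sigma t = O(g t) as t -> +oo, uniformly in 1/2 <= sigma <= 2. *)
Definition bigO_strip (F : R -> R -> R) (g : R -> R) : Prop :=
  exists A : R,
    Rbar_locally p_infty (fun t =>
      forall sigma : R, 1 / 2 <= sigma <= 2 -> Rabs (F sigma t) <= A * g t).

(* Main.v *)
Require Import Defs.
From Stdlib Require Import Reals Lra Lia Psatz Classical IndefiniteDescription.
From Coquelicot Require Import Coquelicot.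
Open Scope R_scope.

(* The equivalence needs only that zeta_2 has polynomial growth in t, and is Lipschitz in t with
   a polynomially growing constant, uniformly in the strip 1/2 <= sigma <= 2.  Then (a) => (b) is
   an integration.  For (b) => (a): if |zeta_2(sigma + i t)| = m, then |zeta_2| >= m/2 on an
   interval of length >> m t^(-2) starting at t, so m^(2k+1) << t^4 by the 2k-th moment, and k is
   arbitrary.

   Growth: with A(u) = u^(1-r) / (h (r-1)) + u^(-r) / 2, the trapezoid rule gives
   u^(-r) = A(u) - A(u+h) + O(|r| |r+1| u^(-Re r - 2)).  Summing over n (step w), and then over m
   (step v, with r = s - 1 and r = s), continues the double series to Re s > 1/4, Im s > 1 with
   size O(t^2); Cauchy's estimate on squares gives the Lipschitz bound.

   The given function agrees with this continuation by unique continuation leftwards along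
   horizontal lines: if f vanishes near a, Cauchy's formula applied to f(z) / (z - a)^n with
   n -> oo shows that f vanishes on a larger disc.  Complex differentiability is only assumed
   pointwise, so Cauchy's formula is proved from Goursat's lemma for rectangles. *)

(** * Complex differentiability *)

(** The trapezoid error for the exponent r decays like u^(-Re r - 2), so the double sum of errors
    with r = s needs Re s > 0, and so does the single sum with r = s - 1; working in Re s > 1/4
    leaves room to the left of 1/2 for Cauchy's estimate. The factor |r| |r+1| is the source of t^2,
    and since k is arbitrary in (b) any fixed power of t would serve. The denominators of the
    continuation vanish only at s = 1 and s = 2, which Im s > 1 avoids at no cost because t tends to
    infinity.

    All contours are axis-parallel rectangles: they split exactly into smaller ones and their sides
    are ordinary real integrals. The price is a worse absolute constant in each estimate, which is
    harmless here.

    The delicate point is uniqueness. The given function is only known to be meromorphic, with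
    arbitrary values at its poles, so poles inside the strip must be ruled out while the equality is
    carried to the left; this is done by clearing the denominator locally. *)

Definition Cdiff (f : C -> C) (z l : C) : Prop :=
  forall eps : R, 0 < eps -> exists delta : R, 0 < delta /\
    forall h : C, Cmod h < delta ->
      Cmod (f (z + h) - f z - h * l)%C <= eps * Cmod h.

Definition Cdiffable (f : C -> C) (z : C) : Prop := exists l, Cdiff f z l.

Lemma Cmod_le_parts (z : C) : Cmod z <= Rabs (Re z) + Rabs (Im z).
Proof.
  unfold Cmod. apply Rsqr_incr_0_var.
  - rewrite Rsqr_sqrt by nra. unfold Rsqr.
    pose proof (Rabs_pos (fst z)). pose proof (Rabs_pos (snd z)).
    rewrite <- (pow2_abs (fst z)), <- (pow2_abs (snd z)). unfold Re, Im. nra.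
  - pose proof (Rabs_pos (Re z)). pose proof (Rabs_pos (Im z)). lra.
Qed.

Lemma Im_le_Cmod (z : C) : Rabs (Im z) <= Cmod z.
Proof. eapply Rle_trans; [apply Rmax_r | apply Rmax_Cmod]. Qed.

Lemma Cmod_triangle_inv (a b : C) : Cmod a - Cmod b <= Cmod (a - b)%C.
Proof.
  pose proof (Cmod_triangle (a - b)%C b).
  replace (a - b + b)%C with a in H by ring. lra.
Qed.

Lemma Cmod_minus_sym (a b : C) : Cmod (a - b)%C = Cmod (b - a)%C.
Proof. rewrite <- Cmod_opp. f_equal. ring. Qed.

Lemma C_eq (a b : C) : Re a = Re b -> Im a = Im b -> a = b.
Proof. apply injective_projections. Qed.

Lemma Cdiff_cont f z l : Cdiff f z l ->
  forall eps, 0 < eps -> exists delta, 0 < delta /\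
    forall h, Cmod h < delta -> Cmod (f (z + h) - f z)%C < eps.
Proof.
  intros H eps He. destruct (H 1 Rlt_0_1) as (d & Hd & H1).
  pose proof (Cmod_ge_0 l) as Hl.
  exists (Rmin d (eps / (Cmod l + 2))). split.
  { apply Rmin_pos; [lra | apply Rdiv_lt_0_compat; lra]. }
  intros h Hh.
  pose proof (Rlt_le_trans _ _ _ Hh (Rmin_l _ _)) as Ha.
  pose proof (Rlt_le_trans _ _ _ Hh (Rmin_r _ _)) as Hb.
  specialize (H1 h Ha).
  replace (f (z + h) - f z)%C with ((f (z + h) - f z - h * l) + h * l)%C by ring.
  eapply Rle_lt_trans; [apply Cmod_triangle |].
  rewrite Cmod_mult.
  apply (Rmult_lt_compat_r (Cmod l + 2)) in Hb; [| lra].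
  replace (eps / (Cmod l + 2) * (Cmod l + 2)) with eps in Hb by (field; lra).
  pose proof (Cmod_ge_0 h). nra.
Qed.

Lemma Cdiff_ext_loc f g z l : 
  (exists r, 0 < r /\ forall h, Cmod h < r -> f (z + h)%C = g (z + h)%C) ->
  Cdiff f z l -> Cdiff g z l.
Proof.
  intros (r & Hr & E) H eps He. destruct (H eps He) as (d & Hd & H1).
  exists (Rmin d r). split; [apply Rmin_pos; lra |].
  intros h Hh.
  pose proof (Rlt_le_trans _ _ _ Hh (Rmin_l _ _)) as Ha.
  pose proof (Rlt_le_trans _ _ _ Hh (Rmin_r _ _)) as Hb.
  rewrite <- (E h Hb).
  assert (E0 : f z = g z).
  { specialize (E (RtoC 0)). rewrite Cmod_0 in E. specialize (E Hr).
    replace (z + 0)%C with z in E by ring. exact E. }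
  rewrite <- E0. apply H1, Ha.
Qed.

Lemma Cdiff_const c z : Cdiff (fun _ => c) z (RtoC 0).
Proof.
  intros eps He. exists 1. split; [lra |]. intros h _.
  replace (c - c - h * 0)%C with (RtoC 0) by ring. rewrite Cmod_0.
  pose proof (Cmod_ge_0 h). nra.
Qed.

Lemma Cdiff_id z : Cdiff (fun s => s) z (RtoC 1).
Proof.
  intros eps He. exists 1. split; [lra |]. intros h _.
  replace (z + h - z - h * 1)%C with (RtoC 0) by ring. rewrite Cmod_0.
  pose proof (Cmod_ge_0 h). nra.
Qed.

Lemma Cdiff_plus f g z l m : Cdiff f z l -> Cdiff g z m ->
  Cdiff (fun s => f s + g s)%C z (l + m)%C.
Proof.
  intros Hf Hg eps He.
  destruct (Hf (eps / 2)) as (d1 & Hd1 & H1); [lra |].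
  destruct (Hg (eps / 2)) as (d2 & Hd2 & H2); [lra |].
  exists (Rmin d1 d2). split; [apply Rmin_pos; lra |]. intros h Hh.
  specialize (H1 h (Rlt_le_trans _ _ _ Hh (Rmin_l _ _))).
  specialize (H2 h (Rlt_le_trans _ _ _ Hh (Rmin_r _ _))).
  replace (f (z + h) + g (z + h) - (f z + g z) - h * (l + m))%C
    with ((f (z + h) - f z - h * l) + (g (z + h) - g z - h * m))%C by ring.
  eapply Rle_trans; [apply Cmod_triangle | lra].
Qed.

Lemma Cdiff_mult f g z l m : Cdiff f z l -> Cdiff g z m ->
  Cdiff (fun s => f s * g s)%C z (l * g z + f z * m)%C.
Proof.
  intros Hf Hg eps He.
  pose proof (Cmod_ge_0 (f z)) as F0. pose proof (Cmod_ge_0 (g z)) as G0.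
  pose proof (Cmod_ge_0 l) as L0.
  (* Each summand of [K] pays for one of the four terms into which the remainder is split below;
     together they cost [q * K = eps / 4]. *)
  set (K := Cmod (f z) + Cmod (g z) + Cmod l + 1).
  assert (HK : 0 < eps / (4 * K)) by (apply Rdiv_lt_0_compat; unfold K; lra).
  destruct (Hf _ HK) as (d1 & Hd1 & H1).
  destruct (Hg _ HK) as (d2 & Hd2 & H2).
  assert (HK2 : 0 < Rmin 1 (eps / (4 * K))) by (apply Rmin_pos; lra).
  destruct (Cdiff_cont _ _ _ Hg _ HK2) as (d3 & Hd3 & H3).
  exists (Rmin d1 (Rmin d2 d3)). split; [repeat apply Rmin_pos; lra |].
  intros h Hh.
  specialize (H1 h (Rlt_le_trans _ _ _ Hh (Rmin_l _ _))).
  pose proof (Rlt_le_trans _ _ _ Hh (Rmin_r _ _)) as Hh'.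
  specialize (H2 h (Rlt_le_trans _ _ _ Hh' (Rmin_l _ _))).
  specialize (H3 h (Rlt_le_trans _ _ _ Hh' (Rmin_r _ _))).
  pose proof (Rlt_le_trans _ _ _ H3 (Rmin_l _ _)) as H3a.
  pose proof (Rlt_le_trans _ _ _ H3 (Rmin_r _ _)) as H3b.
  set (q := eps / (4 * K)) in *.
  assert (Hq : q * K = eps / 4) by (unfold q; field; unfold K; lra).
  replace (f (z + h) * g (z + h) - f z * g z - h * (l * g z + f z * m))%C
    with ((f (z + h) - f z - h * l) * (g (z + h) - g z)
        + (f (z + h) - f z - h * l) * g z
        + (f z * (g (z + h) - g z - h * m)
        + h * l * (g (z + h) - g z)))%C by ring.
  pose proof (Cmod_ge_0 h) as h0.
  eapply Rle_trans; [apply Cmod_triangle |].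
  eapply Rle_trans; [apply Rplus_le_compat; apply Cmod_triangle |].
  rewrite !Cmod_mult.
  set (A := Cmod (f (z + h) - f z - h * l)%C) in *.
  set (B := Cmod (g (z + h) - g z - h * m)%C) in *.
  set (D := Cmod (g (z + h) - g z)%C) in *.
  assert (0 <= A) by apply Cmod_ge_0. assert (0 <= D) by apply Cmod_ge_0.
  assert (0 <= q * Cmod h) by (apply Rmult_le_pos; lra).
  assert (A * D <= q * Cmod h) by nra.
  assert (A * Cmod (g z) <= (q * Cmod h) * Cmod (g z)) by (apply Rmult_le_compat_r; lra).
  assert (Cmod (f z) * B <= (q * Cmod h) * Cmod (f z)) by nra.
  assert (Cmod h * Cmod l * D <= (q * Cmod h) * Cmod l).
  { replace (q * Cmod h * Cmod l) with (Cmod h * Cmod l * q) by ring.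
    apply Rmult_le_compat_l; [apply Rmult_le_pos; lra | lra]. }
  apply Rle_trans with (q * K * Cmod h); [unfold K; nra | rewrite Hq; nra].
Qed.

(** The remainder is exactly h^2 / ((z + h) z^2), and |h| < |z| / 2 keeps |z + h| above |z| / 2. *)
Lemma Cdiff_inv z : z <> (RtoC 0) -> Cdiff (fun s => / s)%C z (- / (z * z))%C.
Proof.
  intros Hz eps He. apply Cmod_gt_0 in Hz as Hm.
  set (m := Cmod z) in *.
  exists (Rmin (m / 2) (eps * (m * m * m) / 2)). split.
  { apply Rmin_pos; [lra |]. 
    assert (0 < m * m * m) by (repeat apply Rmult_lt_0_compat; lra). nra. }
  intros h Hh.
  pose proof (Rlt_le_trans _ _ _ Hh (Rmin_l _ _)) as Ha.
  pose proof (Rlt_le_trans _ _ _ Hh (Rmin_r _ _)) as Hb.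
  assert (Hzh : m / 2 <= Cmod (z + h)%C).
  { pose proof (Cmod_triangle_inv z (- h)%C). rewrite Cmod_opp in H.
    replace (z - - h)%C with (z + h)%C in H by ring. fold m in H. lra. }
  assert (Hnz : (z + h)%C <> (RtoC 0)) by (apply Cmod_gt_0; lra).
  replace (/ (z + h) - / z - h * - / (z * z))%C
    with (h * h * / ((z + h) * z * z))%C by (field; auto).
  rewrite !Cmod_mult, Cmod_inv, !Cmod_mult.
  2:{ repeat apply Cmult_neq_0; auto. }
  fold m. pose proof (Cmod_ge_0 h).
  replace (Cmod h * Cmod h * / (Cmod (z + h) * m * m))
    with (Cmod h * (Cmod h / (Cmod (z + h) * m * m))) by (unfold Rdiv; ring).
  rewrite (Rmult_comm eps). apply Rmult_le_compat_l; [lra |].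
  assert (P : 0 < m / 2 * m * m) by (repeat apply Rmult_lt_0_compat; lra).
  assert (P2 : m / 2 * m * m <= Cmod (z + h) * m * m).
  { apply Rmult_le_compat_r; [lra |]. apply Rmult_le_compat_r; lra. }
  apply Rle_div_l; [lra |].
  apply Rle_trans with (eps * (m / 2 * m * m)); [nra |].
  apply Rmult_le_compat_l; lra.
Qed.

Lemma Cdiff_comp f g z l m : Cdiff g z m -> Cdiff f (g z) l ->
  Cdiff (fun s => f (g s)) z (m * l)%C.
Proof.
  intros Hg Hf eps He.
  pose proof (Cmod_ge_0 l) as L0. pose proof (Cmod_ge_0 m) as M0.
  assert (Q1 : 0 < eps / (2 * (Cmod m + 1))) by (apply Rdiv_lt_0_compat; lra).
  (* The 1 bounds the increment of [g] by (|m| + 1) |h|, which converts the error of [f] into an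
     error in h. *)
  assert (Q2 : 0 < Rmin 1 (eps / (2 * (Cmod l + 1)))).
  { apply Rmin_pos; [lra | apply Rdiv_lt_0_compat; lra]. }
  destruct (Hf _ Q1) as (d1 & Hd1 & H1).
  destruct (Hg _ Q2) as (d2 & Hd2 & H2).
  destruct (Cdiff_cont _ _ _ Hg _ Hd1) as (d3 & Hd3 & H3).
  exists (Rmin d2 d3). split; [apply Rmin_pos; lra |]. intros h Hh.
  specialize (H2 h (Rlt_le_trans _ _ _ Hh (Rmin_l _ _))).
  specialize (H3 h (Rlt_le_trans _ _ _ Hh (Rmin_r _ _))).
  specialize (H1 _ H3).
  replace (g z + (g (z + h) - g z))%C with (g (z + h)%C) in H1 by ring.
  replace (f (g (z + h)%C) - f (g z) - h * (m * l))%C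
    with ((f (g (z + h)%C) - f (g z) - (g (z + h) - g z) * l)
           + (g (z + h) - g z - h * m) * l)%C by ring.
  pose proof (Cmod_ge_0 h).
  eapply Rle_trans; [apply Cmod_triangle |]. rewrite Cmod_mult.
  set (A := Cmod (g (z + h) - g z - h * m)%C) in *.
  assert (HD : Cmod (g (z + h) - g z)%C <= A + Cmod h * Cmod m).
  { rewrite <- Cmod_mult. unfold A. 
    eapply Rle_trans; [| apply Cmod_triangle]. right. f_equal. ring. }
  assert (A1 : A <= 1 * Cmod h).
  { eapply Rle_trans; [apply H2 |]. apply Rmult_le_compat_r; [lra | apply Rmin_l]. }
  assert (A2 : A <= eps / (2 * (Cmod l + 1)) * Cmod h).
  { eapply Rle_trans; [apply H2 |]. apply Rmult_le_compat_r; [lra | apply Rmin_r]. }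
  assert (B1 : eps / (2 * (Cmod m + 1)) * Cmod (g (z + h) - g z)%C <= eps / 2 * Cmod h).
  { apply Rle_trans with (eps / (2 * (Cmod m + 1)) * ((Cmod m + 1) * Cmod h)).
    - apply Rmult_le_compat_l; [lra | nra].
    - right. field. lra. }
  assert (B2 : A * Cmod l <= eps / 2 * Cmod h).
  { apply Rle_trans with (eps / (2 * (Cmod l + 1)) * Cmod h * (Cmod l + 1)).
    - apply Rmult_le_compat; try lra. apply Cmod_ge_0.
    - right. field. lra. }
  lra.
Qed.

Lemma Cdiffable_const c z : Cdiffable (fun _ => c) z.
Proof. eexists; apply Cdiff_const. Qed.
Lemma Cdiffable_id z : Cdiffable (fun s => s) z.
Proof. eexists; apply Cdiff_id. Qed.
Lemma Cdiffable_plus f g z : Cdiffable f z -> Cdiffable g z ->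
  Cdiffable (fun s => f s + g s)%C z.
Proof. intros [l Hl] [m Hm]. eexists; apply Cdiff_plus; eauto. Qed.
Lemma Cdiffable_mult f g z : Cdiffable f z -> Cdiffable g z ->
  Cdiffable (fun s => f s * g s)%C z.
Proof. intros [l Hl] [m Hm]. eexists; apply Cdiff_mult; eauto. Qed.
Lemma Cdiffable_comp f g z : Cdiffable g z -> Cdiffable f (g z) ->
  Cdiffable (fun s => f (g s)) z.
Proof. intros [l Hl] [m Hm]. eexists; eapply Cdiff_comp; eauto. Qed.
Lemma Cdiffable_ext f g z : (forall s, f s = g s) -> Cdiffable f z -> Cdiffable g z.
Proof.
  intros E [l Hl]. exists l. eapply Cdiff_ext_loc; [| eauto].
  exists 1. split; [lra | auto].
Qed.
Lemma Cdiffable_opp f z : Cdiffable f z -> Cdiffable (fun s => - f s)%C z.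
Proof.
  intros H. apply Cdiffable_ext with (fun s => (-(1)) * f s)%C; [intros; ring |].
  apply Cdiffable_mult; [apply Cdiffable_const | exact H].
Qed.
Lemma Cdiffable_minus f g z : Cdiffable f z -> Cdiffable g z ->
  Cdiffable (fun s => f s - g s)%C z.
Proof. intros. apply Cdiffable_plus; [| apply Cdiffable_opp]; assumption. Qed.
Lemma Cdiffable_inv f z : Cdiffable f z -> f z <> (RtoC 0) ->
  Cdiffable (fun s => / f s)%C z.
Proof.
  intros Hf Hz. apply (Cdiffable_comp (fun s => / s)%C f); [exact Hf |].
  eexists; apply Cdiff_inv, Hz.
Qed.
Lemma Cdiffable_pow f n z : Cdiffable f z -> Cdiffable (fun s => f s ^ n)%C z.
Proof.
  intros Hf. induction n as [| n IH].
  - apply (Cdiffable_const (RtoC 1)).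
  - apply Cdiffable_ext with (fun s => f s * f s ^ n)%C.
    + intros; rewrite Cpow_S; reflexivity.
    + apply Cdiffable_mult; assumption.
Qed.

Lemma Cdiffable_cont f z : Cdiffable f z ->
  forall eps, 0 < eps -> exists delta, 0 < delta /\
    forall h, Cmod h < delta -> Cmod (f (z + h) - f z)%C < eps.
Proof. intros [l Hl]. eapply Cdiff_cont; eauto. Qed.

Lemma continuous_eps (f : R -> R) x :
  (forall eps, 0 < eps -> exists delta, 0 < delta /\
     forall y, Rabs (y - x) < delta -> Rabs (f y - f x) < eps) ->
  continuous f x.
Proof.
  intros H. apply filterlim_locally. intros eps.
  destruct (H eps (cond_pos eps)) as (d & Hd & H1).
  exists (mkposreal d Hd). intros y Hy. apply H1, Hy.
Qed.

(** Treats horizontal and vertical sides at once: there one coordinate is the identity and the other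
    is constant, and both are nonexpansive. *)
Lemma Cdiffable_cont_path f (p q : R -> R) x :
  (forall y, Rabs (p y - p x) <= Rabs (y - x)) ->
  (forall y, Rabs (q y - q x) <= Rabs (y - x)) ->
  Cdiffable f (p x, q x) ->
  continuous (fun y => Re (f (p y, q y))) x /\ continuous (fun y => Im (f (p y, q y))) x.
Proof.
  intros Hp Hq Hf.
  assert (H : forall eps, 0 < eps -> exists delta, 0 < delta /\
     forall y, Rabs (y - x) < delta -> Cmod (f (p y, q y) - f (p x, q x))%C < eps).
  { intros eps He. destruct (Cdiffable_cont _ _ Hf eps He) as (d & Hd & H1).
    exists (d / 2). split; [lra |]. intros y Hy.
    specialize (H1 (p y - p x, q y - q x)).
    replace (Cplus (p x, q x) (p y - p x, q y - q x)) with ((p y, q y) : C) in H1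
      by (apply C_eq; simpl; ring).
    apply H1. eapply Rle_lt_trans; [apply Cmod_le_parts |]. simpl.
    specialize (Hp y). specialize (Hq y). lra. }
  split; apply continuous_eps; intros eps He;
    destruct (H eps He) as (d & Hd & H1); exists d; (split; [exact Hd |]);
    intros y Hy; eapply Rle_lt_trans; [| apply (H1 y Hy) | | apply (H1 y Hy)].
  - apply (re_le_Cmod (f (p y, q y) - f (p x, q x))%C).
  - apply (Im_le_Cmod (f (p y, q y) - f (p x, q x))%C).
Qed.

(** * Rectangle integrals and Goursat's lemma *)

Definition CRcont (g : R -> C) (x : R) : Prop :=
  continuous (fun y => Re (g y)) x /\ continuous (fun y => Im (g y)) x.

Definition CInt (g : R -> C) (a b : R) : C :=
  (RInt (fun x => Re (g x)) a b, RInt (fun x => Im (g x)) a b).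

Lemma ex_RInt_cont (f : R -> R) a b : a <= b ->
  (forall x, a <= x <= b -> continuous f x) -> ex_RInt f a b.
Proof.
  intros Hab H. apply (ex_RInt_continuous (V := R_CompleteNormedModule)).
  rewrite Rmin_left, Rmax_right; auto.
Qed.

Lemma CInt_ext g1 g2 a b : a <= b ->
  (forall x, a <= x <= b -> g1 x = g2 x) -> CInt g1 a b = CInt g2 a b.
Proof.
  intros Hab H. unfold CInt.
  f_equal; apply RInt_ext; rewrite Rmin_left, Rmax_right by lra;
    intros x Hx; rewrite H; auto; lra.
Qed.

Lemma CInt_plus g1 g2 a b : a <= b ->
  (forall x, a <= x <= b -> CRcont g1 x) -> (forall x, a <= x <= b -> CRcont g2 x) ->
  CInt (fun x => g1 x + g2 x)%C a b = (CInt g1 a b + CInt g2 a b)%C.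
Proof.
  intros Hab H1 H2. apply C_eq; simpl.
  - apply (RInt_plus (V := R_CompleteNormedModule)); apply ex_RInt_cont; auto; apply H1 || apply H2.
  - apply (RInt_plus (V := R_CompleteNormedModule)); apply ex_RInt_cont; auto; apply H1 || apply H2.
Qed.

Lemma CInt_scal (c : C) g a b : a <= b ->
  (forall x, a <= x <= b -> CRcont g x) ->
  CInt (fun x => c * g x)%C a b = (c * CInt g a b)%C.
Proof.
  intros Hab H.
  assert (E1 : ex_RInt (fun x => Re (g x)) a b) by (apply ex_RInt_cont; auto; apply H).
  assert (E2 : ex_RInt (fun x => Im (g x)) a b) by (apply ex_RInt_cont; auto; apply H).
  apply (RInt_correct (V := R_CompleteNormedModule)) in E1.
  apply (RInt_correct (V := R_CompleteNormedModule)) in E2.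
  apply C_eq; simpl; apply is_RInt_unique.
  - apply (is_RInt_minus (V := R_NormedModule)); apply (is_RInt_scal (V := R_NormedModule)); assumption.
  - apply (is_RInt_plus (V := R_NormedModule)); apply (is_RInt_scal (V := R_NormedModule)); assumption.
Qed.

Lemma CInt_Chasles g a b c : a <= b -> b <= c ->
  (forall x, a <= x <= c -> CRcont g x) ->
  (CInt g a b + CInt g b c)%C = CInt g a c.
Proof.
  intros Hab Hbc H. apply C_eq; simpl;
    apply (RInt_Chasles (V := R_CompleteNormedModule)); apply ex_RInt_cont; auto;
    intros x Hx; apply H; lra.
Qed.

(** The factor 2 comes from estimating real and imaginary parts separately. *)
Lemma CInt_bound g a b M : a <= b ->
  (forall x, a <= x <= b -> CRcont g x) ->
  (forall x, a <= x <= b -> Cmod (g x) <= M) ->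
  Cmod (CInt g a b) <= 2 * M * (b - a).
Proof.
  intros Hab H HM. eapply Rle_trans; [apply Cmod_le_parts |]. simpl.
  assert (B1 : Rabs (RInt (fun x => Re (g x)) a b) <= (b - a) * M).
  { apply (norm_RInt_le_const (V := R_NormedModule) (fun x => Re (g x)) a b); auto.
    - intros x Hx. eapply Rle_trans; [apply re_le_Cmod | auto].
    - apply (RInt_correct (V := R_CompleteNormedModule)). apply ex_RInt_cont; auto; apply H. }
  assert (B2 : Rabs (RInt (fun x => Im (g x)) a b) <= (b - a) * M).
  { apply (norm_RInt_le_const (V := R_NormedModule) (fun x => Im (g x)) a b); auto.
    - intros x Hx. eapply Rle_trans; [apply Im_le_Cmod | auto].
    - apply (RInt_correct (V := R_CompleteNormedModule)). apply ex_RInt_cont; auto; apply H. }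
  lra.
Qed.

Lemma Cdiffable_cont_h f x y : Cdiffable f (x, y) -> CRcont (fun x => f (x, y)) x.
Proof.
  intros H. apply (Cdiffable_cont_path f (fun x => x) (fun _ => y)); auto.
  - intros; lra.
  - intros. rewrite Rminus_diag, Rabs_R0. apply Rabs_pos.
Qed.

Lemma Cdiffable_cont_v f x y : Cdiffable f (x, y) -> CRcont (fun y => f (x, y)) y.
Proof.
  intros H. apply (Cdiffable_cont_path f (fun _ => x) (fun y => y)); auto.
  - intros. rewrite Rminus_diag, Rabs_R0. apply Rabs_pos.
  - intros; lra.
Qed.

(** The counterclockwise contour integral: bottom minus top, plus i times right minus left, since dz
    = i dy on the vertical sides. *)
Definition rectI (f : C -> C) (x1 x2 y1 y2 : R) : C :=
  (CInt (fun x => f (x, y1)) x1 x2 - CInt (fun x => f (x, y2)) x1 x2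
   + Ci * (CInt (fun y => f (x2, y)) y1 y2 - CInt (fun y => f (x1, y)) y1 y2))%C.

Definition in_rect (x1 x2 y1 y2 : R) (z : C) : Prop :=
  x1 <= Re z <= x2 /\ y1 <= Im z <= y2.

(** Hypotheses on integrands are imposed only here, so that kernels such as 1 / (z - p) may be
    singular inside the rectangle. *)
Definition on_bdry (x1 x2 y1 y2 : R) (z : C) : Prop :=
  in_rect x1 x2 y1 y2 z /\ (Re z = x1 \/ Re z = x2 \/ Im z = y1 \/ Im z = y2).

Ltac bdry := unfold on_bdry, in_rect; simpl; lra.

Lemma rectI_ext f g x1 x2 y1 y2 : x1 <= x2 -> y1 <= y2 ->
  (forall z, on_bdry x1 x2 y1 y2 z -> f z = g z) ->
  rectI f x1 x2 y1 y2 = rectI g x1 x2 y1 y2.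
Proof.
  intros Hx Hy H. unfold rectI.
  rewrite (CInt_ext (fun x => f (x, y1)) (fun x => g (x, y1))),
    (CInt_ext (fun x => f (x, y2)) (fun x => g (x, y2))),
    (CInt_ext (fun y => f (x1, y)) (fun y => g (x1, y))),
    (CInt_ext (fun y => f (x2, y)) (fun y => g (x2, y))); auto;
    intros x Hx'; apply H; bdry.
Qed.

Lemma rectI_plus f g x1 x2 y1 y2 : x1 <= x2 -> y1 <= y2 ->
  (forall z, on_bdry x1 x2 y1 y2 z -> Cdiffable f z) ->
  (forall z, on_bdry x1 x2 y1 y2 z -> Cdiffable g z) ->
  rectI (fun z => f z + g z)%C x1 x2 y1 y2
    = (rectI f x1 x2 y1 y2 + rectI g x1 x2 y1 y2)%C.
Proof.
  intros Hx Hy Hf Hg. unfold rectI.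
  rewrite (CInt_plus (fun x => f (x, y1)) (fun x => g (x, y1))),
    (CInt_plus (fun x => f (x, y2)) (fun x => g (x, y2))),
    (CInt_plus (fun y => f (x1, y)) (fun y => g (x1, y))),
    (CInt_plus (fun y => f (x2, y)) (fun y => g (x2, y))); auto;
    try (intros x Hx'; (apply Cdiffable_cont_h || apply Cdiffable_cont_v);
         (apply Hf || apply Hg); bdry).
  ring.
Qed.

Lemma rectI_scal c f x1 x2 y1 y2 : x1 <= x2 -> y1 <= y2 ->
  (forall z, on_bdry x1 x2 y1 y2 z -> Cdiffable f z) ->
  rectI (fun z => c * f z)%C x1 x2 y1 y2 = (c * rectI f x1 x2 y1 y2)%C.
Proof.
  intros Hx Hy Hf. unfold rectI.
  rewrite (CInt_scal c (fun x => f (x, y1))),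
    (CInt_scal c (fun x => f (x, y2))),
    (CInt_scal c (fun y => f (x1, y))),
    (CInt_scal c (fun y => f (x2, y))); auto;
    try (intros x Hx'; (apply Cdiffable_cont_h || apply Cdiffable_cont_v);
         apply Hf; bdry).
  ring.
Qed.

Lemma rectI_bound f x1 x2 y1 y2 M : x1 <= x2 -> y1 <= y2 ->
  (forall z, on_bdry x1 x2 y1 y2 z -> Cdiffable f z) ->
  (forall z, on_bdry x1 x2 y1 y2 z -> Cmod (f z) <= M) ->
  Cmod (rectI f x1 x2 y1 y2) <= 4 * M * ((x2 - x1) + (y2 - y1)).
Proof.
  intros Hx Hy Hf HM. unfold rectI.
  assert (B1 := CInt_bound (fun x => f (x, y1)) x1 x2 M Hx).
  assert (B2 := CInt_bound (fun x => f (x, y2)) x1 x2 M Hx).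
  assert (B3 := CInt_bound (fun y => f (x1, y)) y1 y2 M Hy).
  assert (B4 := CInt_bound (fun y => f (x2, y)) y1 y2 M Hy).
  lapply B1; [clear B1; intro B1 | intros; apply Cdiffable_cont_h, Hf; bdry].
  lapply B2; [clear B2; intro B2 | intros; apply Cdiffable_cont_h, Hf; bdry].
  lapply B3; [clear B3; intro B3 | intros; apply Cdiffable_cont_v, Hf; bdry].
  lapply B4; [clear B4; intro B4 | intros; apply Cdiffable_cont_v, Hf; bdry].
  lapply B1; [clear B1; intro B1 | intros; apply HM; bdry].
  lapply B2; [clear B2; intro B2 | intros; apply HM; bdry].
  lapply B3; [clear B3; intro B3 | intros; apply HM; bdry].
  lapply B4; [clear B4; intro B4 | intros; apply HM; bdry].
  eapply Rle_trans; [apply Cmod_triangle |]. unfold Cminus. rewrite Cmod_mult, Cmod_Ci.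
  eapply Rle_trans; [apply Rplus_le_compat; [apply Cmod_triangle |] |].
  { apply Rmult_le_compat_l; [lra | apply Cmod_triangle]. }
  rewrite !Cmod_opp. lra.
Qed.

(** The integral over the common side occurs twice with opposite signs and cancels as a formal
    expression, so regularity is required on the outer boundary only. *)
Lemma rectI_split_v f x1 x2 x3 y1 y2 : x1 <= x2 -> x2 <= x3 -> y1 <= y2 ->
  (forall z, on_bdry x1 x3 y1 y2 z -> Cdiffable f z) ->
  rectI f x1 x3 y1 y2 = (rectI f x1 x2 y1 y2 + rectI f x2 x3 y1 y2)%C.
Proof.
  intros H12 H23 Hy Hf. unfold rectI.
  rewrite <- (CInt_Chasles (fun x => f (x, y1)) x1 x2 x3),
    <- (CInt_Chasles (fun x => f (x, y2)) x1 x2 x3); auto;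
    try (intros; apply Cdiffable_cont_h, Hf; bdry).
  ring.
Qed.

Lemma rectI_split_h f x1 x2 y1 y2 y3 : x1 <= x2 -> y1 <= y2 -> y2 <= y3 ->
  (forall z, on_bdry x1 x2 y1 y3 z -> Cdiffable f z) ->
  rectI f x1 x2 y1 y3 = (rectI f x1 x2 y1 y2 + rectI f x1 x2 y2 y3)%C.
Proof.
  intros Hx H12 H23 Hf. unfold rectI.
  rewrite <- (CInt_Chasles (fun y => f (x1, y)) y1 y2 y3),
    <- (CInt_Chasles (fun y => f (x2, y)) y1 y2 y3); auto;
    try (intros; apply Cdiffable_cont_v, Hf; bdry).
  ring.
Qed.

Lemma RInt_derive_cont (F f : R -> R) a b : a <= b ->
  (forall x, is_derive F x (f x)) -> (forall x, continuous f x) ->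
  RInt f a b = F b - F a.
Proof.
  intros Hab H1 H2. apply is_RInt_unique.
  apply (is_RInt_derive (V := R_CompleteNormedModule) F f a b); auto.
Qed.

Lemma continuous_of_derive (f : R -> R) x : (exists l, is_derive f x l) -> continuous f x.
Proof. exact (ex_derive_continuous (K := R_AbsRing) (V := R_NormedModule) f x). Qed.

(** Computed from explicit quadratic primitives on the four sides. This is the one case of Cauchy's
    theorem on which Goursat's argument rests. *)
Lemma rectI_affine (a b c : C) x1 x2 y1 y2 : x1 <= x2 -> y1 <= y2 ->
  rectI (fun z => a + (z - c) * b)%C x1 x2 y1 y2 = RtoC 0.
Proof.
  intros Hx Hy. destruct a as [a1 a2], b as [b1 b2], c as [c1 c2].
  unfold rectI, CInt. simpl.
  assert (Hh : forall y, RInt (fun x => a1 + ((x + - c1) * b1 - (y + - c2) * b2)) x1 x2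
     = (a1 - (y - c2) * b2) * (x2 - x1) + b1 * ((x2 - c1) ^ 2 - (x1 - c1) ^ 2) / 2 :> R).
  { intros y. rewrite (RInt_derive_cont
      (fun x => (a1 - (y - c2) * b2) * x + b1 * (x - c1) ^ 2 / 2)); auto.
    - field.
    - intros x. auto_derive; auto. field.
    - intros x. apply continuous_of_derive. eexists. auto_derive; auto. }
  assert (Hh' : forall y, RInt (fun x => a2 + ((x + - c1) * b2 + (y + - c2) * b1)) x1 x2
     = (a2 + (y - c2) * b1) * (x2 - x1) + b2 * ((x2 - c1) ^ 2 - (x1 - c1) ^ 2) / 2 :> R).
  { intros y. rewrite (RInt_derive_cont
      (fun x => (a2 + (y - c2) * b1) * x + b2 * (x - c1) ^ 2 / 2)); auto.
    - field.
    - intros x. auto_derive; auto. field.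
    - intros x. apply continuous_of_derive. eexists. auto_derive; auto. }
  assert (Hv : forall x, RInt (fun y => a1 + ((x + - c1) * b1 - (y + - c2) * b2)) y1 y2
     = (a1 + (x - c1) * b1) * (y2 - y1) - b2 * ((y2 - c2) ^ 2 - (y1 - c2) ^ 2) / 2 :> R).
  { intros x. rewrite (RInt_derive_cont
      (fun y => (a1 + (x - c1) * b1) * y - b2 * (y - c2) ^ 2 / 2)); auto.
    - field.
    - intros y. auto_derive; auto. field.
    - intros y. apply continuous_of_derive. eexists. auto_derive; auto. }
  assert (Hv' : forall x, RInt (fun y => a2 + ((x + - c1) * b2 + (y + - c2) * b1)) y1 y2
     = (a2 + (x - c1) * b2) * (y2 - y1) + b1 * ((y2 - c2) ^ 2 - (y1 - c2) ^ 2) / 2 :> R).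
  { intros x. rewrite (RInt_derive_cont
      (fun y => (a2 + (x - c1) * b2) * y + b1 * (y - c2) ^ 2 / 2)); auto.
    - field.
    - intros y. auto_derive; auto. field.
    - intros y. apply continuous_of_derive. eexists. auto_derive; auto. }
  rewrite !Hh, !Hh', !Hv, !Hv'. apply C_eq; simpl; field.
Qed.

(** * Goursat's lemma by repeated quadrisection *)

Section Quadrisection.

Variables (f : C -> C) (a b : R).
Hypotheses (Ha : 0 <= a) (Hb : 0 <= b).

(** A rectangle of depth n has sides a / 2^n and b / 2^n, hence is determined by its lower left
    corner; the nested sequence of rectangles becomes a sequence of points. *)
Let I (p : R * R) (n : nat) : R :=
  Cmod (rectI f (fst p) (fst p + a / 2 ^ n) (snd p) (snd p + b / 2 ^ n)).

Let corner (p : R * R) (n i j : nat) : R * R :=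
  (fst p + INR i * (a / 2 ^ S n), snd p + INR j * (b / 2 ^ S n)).

(** The first quarter carrying at least a quarter of the integral. The last branch is not tested: by
    the triangle inequality it is right when the other three fail. *)
Let next (n : nat) (p : R * R) : R * R :=
  if Rle_dec (I p n / 4) (I (corner p n 0 0) (S n)) then corner p n 0 0 else
  if Rle_dec (I p n / 4) (I (corner p n 1 0) (S n)) then corner p n 1 0 else
  if Rle_dec (I p n / 4) (I (corner p n 0 1) (S n)) then corner p n 0 1 else
  corner p n 1 1.

Lemma quadrisect_next n p :
  (forall z, in_rect (fst p) (fst p + a / 2 ^ n) (snd p) (snd p + b / 2 ^ n) z ->
     Cdiffable f z) ->
  I p n / 4 <= I (next n p) (S n) /\
  (fst p <= fst (next n p) /\ fst (next n p) + a / 2 ^ S n <= fst p + a / 2 ^ n) /\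
  (snd p <= snd (next n p) /\ snd (next n p) + b / 2 ^ S n <= snd p + b / 2 ^ n).
Proof.
  intros Hf.
  assert (P : 0 < 2 ^ n) by (apply pow_lt; lra).
  assert (Ea : a / 2 ^ n = 2 * (a / 2 ^ S n)) by (simpl; field; lra).
  assert (Eb : b / 2 ^ n = 2 * (b / 2 ^ S n)) by (simpl; field; lra).
  assert (Pa : 0 <= a / 2 ^ S n) by (apply Rdiv_le_0_compat; [lra | apply pow_lt; lra]).
  assert (Pb : 0 <= b / 2 ^ S n) by (apply Rdiv_le_0_compat; [lra | apply pow_lt; lra]).
  assert (T : I p n <= I (corner p n 0 0) (S n) + I (corner p n 1 0) (S n)
     + I (corner p n 0 1) (S n) + I (corner p n 1 1) (S n)).
  { unfold I, corner. rewrite Ea, Eb in Hf |- *. destruct p as [x y]. cbn [fst snd INR] in Hf |- *.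
    set (a' := a / 2 ^ S n) in *. set (b' := b / 2 ^ S n) in *.
    rewrite (rectI_split_v f x (x + a') (x + 2 * a') y (y + 2 * b')),
      (rectI_split_h f x (x + a') y (y + b') (y + 2 * b')),
      (rectI_split_h f (x + a') (x + 2 * a') y (y + b') (y + 2 * b')); try lra;
      try (intros z [Hz _]; apply Hf; revert Hz; unfold in_rect; lra).
    rewrite !Rmult_0_l, !Rmult_1_l, !Rplus_0_r.
    replace (x + a' + a') with (x + 2 * a') by ring.
    replace (y + b' + b') with (y + 2 * b') by ring.
    eapply Rle_trans; [apply Cmod_triangle |].
    eapply Rle_trans; [apply Rplus_le_compat; apply Cmod_triangle |]. lra. }
  unfold next.
  destruct (Rle_dec _ _) as [H1 | H1];
    [| destruct (Rle_dec _ _) as [H2 | H2];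
    [| destruct (Rle_dec _ _) as [H3 | H3]]];
  (split; [assumption || lra |]); unfold corner;
  cbn [fst snd INR]; rewrite Ea, Eb; lra.
Qed.

Let Fixpoint seq (p : R * R) (n : nat) {struct n} : R * R :=
  match n with O => p | S m => next m (seq p m) end.

Lemma quadrisect_seq p : 
  (forall z, in_rect (fst p) (fst p + a) (snd p) (snd p + b) z -> Cdiffable f z) ->
  forall n m, (n <= m)%nat ->
  (I p 0 / 4 ^ m <= I (seq p m) m) /\ (fst (seq p n) <= fst (seq p m) /\
   fst (seq p m) + a / 2 ^ m <= fst (seq p n) + a / 2 ^ n) /\
   (snd (seq p n) <= snd (seq p m) /\
   snd (seq p m) + b / 2 ^ m <= snd (seq p n) + b / 2 ^ n).
Proof.
  intros Hf.
  assert (H0 : forall m, (I p 0 / 4 ^ m <= I (seq p m) m) /\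
    (fst p <= fst (seq p m) /\ fst (seq p m) + a / 2 ^ m <= fst p + a) /\
    (snd p <= snd (seq p m) /\ snd (seq p m) + b / 2 ^ m <= snd p + b)).
  { induction m as [| m IH].
    - simpl. lra.
    - destruct IH as (I1 & I2 & I3).
      destruct (quadrisect_next m (seq p m)) as (J1 & J2 & J3).
      { intros z Hz. apply Hf. revert Hz. unfold in_rect. lra. }
      change (seq p (S m)) with (next m (seq p m)).
      split; [| lra].
      replace (I p 0 / 4 ^ S m) with (I p 0 / 4 ^ m / 4)
        by (simpl; field; apply pow_nonzero; lra).
      lra. }
  intros n m Hnm. split; [apply H0 |].
  induction Hnm as [| m Hnm IH]; [lra |].
  destruct (quadrisect_next m (seq p m)) as (J1 & J2 & J3).
  { intros z Hz. apply Hf. revert Hz. specialize (H0 m). unfold in_rect. lra. }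
  change (seq p (S m)) with (next m (seq p m)). lra.
Qed.

(** The point is the supremum of the left ends, each right end being an upper bound for them. *)
Lemma nested_limit (u : nat -> R) (c : R) : 0 <= c ->
  (forall n m, (n <= m)%nat -> u n <= u m /\ u m + c / 2 ^ m <= u n + c / 2 ^ n) ->
  exists l, forall n, u n <= l <= u n + c / 2 ^ n.
Proof.
  intros Hc H.
  assert (P : forall n, 0 <= c / 2 ^ n)
    by (intros; apply Rdiv_le_0_compat; [lra | apply pow_lt; lra]).
  destruct (completeness (fun x => exists n, x = u n)) as [l [L1 L2]].
  - exists (u O + c / 2 ^ 0). intros x [n ->]. specialize (H O n (Nat.le_0_l n)).
    specialize (P n). lra.
  - exists (u O), O. reflexivity.
  - exists l. intros n. split; [apply L1; exists n; reflexivity |].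
    apply L2. intros x [m ->].
    destruct (Nat.le_ge_cases n m) as [E | E]; specialize (H _ _ E).
    + specialize (P m). lra.
    + specialize (P n). lra.
Qed.

Lemma Goursat_corner p :
  (forall z, in_rect (fst p) (fst p + a) (snd p) (snd p + b) z -> Cdiffable f z) ->
  I p 0 = 0.
Proof.
  intros Hf.
  pose proof (quadrisect_seq p Hf) as HS.
  destruct (nested_limit (fun n => fst (seq p n)) a Ha) as [cx Hcx].
  { intros n m Hnm. apply (HS n m Hnm). }
  destruct (nested_limit (fun n => snd (seq p n)) b Hb) as [cy Hcy].
  { intros n m Hnm. apply (HS n m Hnm). }
  set (c := (cx, cy) : C).
  destruct (Hf c) as [l Hl].
  { specialize (Hcx O). specialize (Hcy O). unfold in_rect, c. simpl in *. lra. }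
  assert (I0 : 0 <= I p 0) by apply Cmod_ge_0.
  apply Rle_antisym; [| exact I0]. apply le_epsilon. intros eps He. rewrite Rplus_0_l.
  (* At depth n the remainder is at most (eps / K) (a + b) / 2^n, so the integral is at most (eps /
     4^n) * 4 (a + b)^2 / K, and this [K] makes the last factor less than 1. The summand 1 keeps it
     positive when the rectangle is a point. *)
  set (K := 4 * (a + b) * (a + b) + 1).
  assert (KP : 0 < K) by (unfold K; nra).
  destruct (Hl (eps / K)) as (d & Hd & H1); [apply Rdiv_lt_0_compat; lra |].
  assert (exists n, (a + b) / 2 ^ n < d) as [n Hn].
  { destruct (Pow_x_infinity 2 ltac:(rewrite Rabs_pos_eq; lra) ((a + b) / d + 1)) as [n Hn].
    exists n. specialize (Hn n (Nat.le_refl n)).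
    assert (P : 0 < 2 ^ n) by (apply pow_lt; lra).
    rewrite Rabs_pos_eq in Hn by lra.
    apply Rlt_div_l; [lra |].
    replace (a + b) with (d * ((a + b) / d)) by (field; lra). nra. }
  assert (P : 0 < 2 ^ n) by (apply pow_lt; lra).
  destruct (HS n n (Nat.le_refl n)) as (Q1 & _).
  destruct (HS O n (Nat.le_0_l n)) as (_ & Q2 & Q3). simpl in Q2, Q3.
  specialize (Hcx n). specialize (Hcy n).
  set (x := fst (seq p n)) in *. set (y := snd (seq p n)) in *.
  assert (Pa : 0 <= a / 2 ^ n) by (apply Rdiv_le_0_compat; lra).
  assert (Pb : 0 <= b / 2 ^ n) by (apply Rdiv_le_0_compat; lra).
  assert (Eab : (a + b) / 2 ^ n = a / 2 ^ n + b / 2 ^ n) by (field; lra).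
  assert (B : I (seq p n) n <= 4 * (eps / K * ((a + b) / 2 ^ n)) * (a / 2 ^ n + b / 2 ^ n)).
  { unfold I. fold x y.
    (* The affine part of [f] at the limit point integrates to 0, and only the differentiability
       remainder is left. *)
    rewrite (rectI_ext f (fun z => (f z - f c - (z - c) * l) + (f c + (z - c) * l))%C);
      [| lra | lra | intros; ring].
    assert (Df : forall z, on_bdry x (x + a / 2 ^ n) y (y + b / 2 ^ n) z ->
       Cdiffable (fun z => f z - f c - (z - c) * l)%C z).
    { intros z [Hz _]. repeat (apply Cdiffable_minus || apply Cdiffable_mult ||
        apply Cdiffable_id || apply Cdiffable_const).
      apply Hf. revert Hz. unfold in_rect. lra. }
    rewrite rectI_plus; [| lra | lra | exact Df |].
    2:{ intros z _. apply Cdiffable_plus; [apply Cdiffable_const |].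
        apply Cdiffable_mult; [| apply Cdiffable_const].
        apply Cdiffable_minus; [apply Cdiffable_id | apply Cdiffable_const]. }
    rewrite rectI_affine by lra. rewrite Cplus_0_r.
    replace (a / 2 ^ n + b / 2 ^ n) with
      ((x + a / 2 ^ n - x) + (y + b / 2 ^ n - y)) by ring.
    apply rectI_bound; [lra | lra | exact Df |].
    intros z [Hz _].
    assert (Hzc : Cmod (z - c)%C <= (a + b) / 2 ^ n).
    { eapply Rle_trans; [apply Cmod_le_parts |]. unfold in_rect in Hz.
      simpl. unfold Re, Im in Hz. rewrite Eab.
      apply Rplus_le_compat; apply Rabs_le; lra. }
    assert (Hz2 := H1 (z - c)%C ltac:(lra)).
    replace (c + (z - c))%C with z in Hz2 by ring.
    eapply Rle_trans; [apply Hz2 |]. apply Rmult_le_compat_l; [| exact Hzc].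
    apply Rlt_le, Rdiv_lt_0_compat; lra. }
  rewrite <- Eab in B.
  assert (B2 : I p 0 / 4 ^ n <= eps / 4 ^ n).
  { eapply Rle_trans; [apply Q1 |]. eapply Rle_trans; [apply B |].
    replace (4 ^ n) with (2 ^ n * 2 ^ n) by (rewrite <- Rpow_mult_distr; f_equal; lra).
    replace (4 * (eps / K * ((a + b) / 2 ^ n)) * ((a + b) / 2 ^ n))
      with ((eps / (2 ^ n * 2 ^ n)) * (4 * (a + b) * (a + b) / K)) by (field; lra).
    rewrite <- (Rmult_1_r (eps / (2 ^ n * 2 ^ n))) at 2.
    apply Rmult_le_compat_l.
    - apply Rlt_le, Rdiv_lt_0_compat; nra.
    - apply Rle_div_l; [lra | rewrite Rmult_1_l; unfold K; lra]. }
  apply (Rmult_le_compat_r (4 ^ n)) in B2; [| apply pow_le; lra].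
  replace (I p 0 / 4 ^ n * 4 ^ n) with (I p 0) in B2 by (field; apply pow_nonzero; lra).
  replace (eps / 4 ^ n * 4 ^ n) with eps in B2 by (field; apply pow_nonzero; lra).
  exact B2.
Qed.

End Quadrisection.

Lemma Goursat f x1 x2 y1 y2 : x1 <= x2 -> y1 <= y2 ->
  (forall z, in_rect x1 x2 y1 y2 z -> Cdiffable f z) ->
  rectI f x1 x2 y1 y2 = RtoC 0.
Proof.
  intros Hx Hy Hf. apply Cmod_eq_0.
  pose proof (Goursat_corner f (x2 - x1) (y2 - y1) ltac:(lra) ltac:(lra) (x1, y1)) as H.
  simpl in H.
  replace (x1 + (x2 - x1)) with x2 in H by ring.
  replace (y1 + (y2 - y1)) with y2 in H by ring.
  replace (x1 + (x2 - x1) / 1) with x2 in H by field.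
  replace (y1 + (y2 - y1) / 1) with y2 in H by field.
  exact (H Hf).
Qed.

(** * Cauchy's formula and unique continuation *)

Ltac cdiff := repeat (apply Cdiffable_const || apply Cdiffable_id || apply Cdiffable_minus ||
  apply Cdiffable_opp || apply Cdiffable_plus || apply Cdiffable_mult || apply Cdiffable_pow ||
  apply Cdiffable_inv).

(** The region between the rectangle and the central square consists of four rectangles (left,
    right, below, above) avoiding the centre, on which Goursat's lemma applies. *)
Lemma rectI_shrink f (p1 p2 d x1 x2 y1 y2 : R) : 0 < d ->
  x1 <= p1 - d -> p1 + d <= x2 -> y1 <= p2 - d -> p2 + d <= y2 ->
  (forall z, in_rect x1 x2 y1 y2 z -> z <> (p1, p2) -> Cdiffable f z) ->
  rectI f x1 x2 y1 y2 = rectI f (p1 - d) (p1 + d) (p2 - d) (p2 + d).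
Proof.
  intros Hd H1 H2 H3 H4 Hf.
  assert (Hf' : forall z, in_rect x1 x2 y1 y2 z -> (Re z <> p1 \/ Im z <> p2) -> Cdiffable f z).
  { intros z Hz Hn. apply Hf; auto. intros ->. simpl in Hn. tauto. }
  rewrite (rectI_split_v f x1 (p1 - d) x2), (rectI_split_v f (p1 - d) (p1 + d) x2),
    (rectI_split_h f (p1 - d) (p1 + d) y1 (p2 - d) y2),
    (rectI_split_h f (p1 - d) (p1 + d) (p2 - d) (p2 + d) y2);
    try lra; try (intros z Hz; apply Hf'; unfold on_bdry, in_rect in *; lra).
  rewrite (Goursat f x1 (p1 - d)), (Goursat f (p1 + d) x2),
    (Goursat f (p1 - d) (p1 + d) y1), (Goursat f (p1 - d) (p1 + d) (p2 + d));
    try lra; try (intros z Hz; apply Hf'; unfold in_rect in *; lra).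
  ring.
Qed.

Definition two_pi_i : C := (0, 2 * PI).

Ltac sqnz := repeat match goal with |- _ /\ _ => split | |- True => exact I end;
  apply Rgt_not_eq; unfold Rgt; first [lra | nra |
    match goal with
    | |- context [?a + - ?b] => pose proof (pow2_ge_0 (a + - b)); nra
    | |- context [?a - ?b] => pose proof (pow2_ge_0 (a - b)); nra
    end].

(** The angle under which a side of a square is seen from the centre. *)
Lemma RInt_atan p d : 0 < d ->
  RInt (fun x => d / ((x - p) ^ 2 + d ^ 2)) (p - d) (p + d) = PI / 2 :> R.
Proof.
  intros Hd. rewrite (RInt_derive_cont (fun x => atan ((x - p) / d))).
  - replace ((p + d - p) / d) with 1 by (field; lra).
    replace ((p - d - p) / d) with (- (1)) by (field; lra).
    rewrite atan_opp, atan_1. field.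
  - lra.
  - intros x. auto_derive; auto. field. sqnz.
  - intros x. apply continuous_of_derive. eexists. auto_derive; [sqnz | reflexivity].
Qed.

(** Every side contributes i PI / 2. The remaining parts [A p1] and [A p2] cancel between opposite
    sides and are never evaluated. *)
Lemma rectI_inv (p1 p2 d : R) : 0 < d ->
  rectI (fun z => / (z - (p1, p2)))%C (p1 - d) (p1 + d) (p2 - d) (p2 + d) = two_pi_i.
Proof.
  intros Hd. unfold rectI.
  pose (A := fun p : R => RInt (fun x => (x - p) / ((x - p) ^ 2 + d ^ 2)) (p - d) (p + d)).
  assert (B : CInt (fun x => / ((x, p2 - d)%R - (p1, p2)))%C (p1 - d) (p1 + d) = (A p1, PI / 2)).
  { unfold CInt. rewrite <- (RInt_atan p1 d Hd). unfold A.
    f_equal; apply RInt_ext; intros x _; simpl; field; sqnz. }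
  assert (T : CInt (fun x => / ((x, p2 + d)%R - (p1, p2)))%C (p1 - d) (p1 + d) = (A p1, - (PI / 2))).
  { unfold CInt. rewrite <- (RInt_atan p1 d Hd). unfold A.
    rewrite <- (RInt_opp (V := R_CompleteNormedModule)).
    2:{ apply ex_RInt_cont; [lra |]. intros. apply continuous_of_derive. eexists.
        auto_derive; [sqnz | reflexivity]. }
    f_equal; apply RInt_ext; intros x _; unfold opp; simpl; field; sqnz. }
  assert (Rr : CInt (fun y => / ((p1 + d, y)%R - (p1, p2)))%C (p2 - d) (p2 + d) = (PI / 2, - A p2)).
  { unfold CInt. rewrite <- (RInt_atan p2 d Hd). unfold A.
    rewrite <- (RInt_opp (V := R_CompleteNormedModule)).
    2:{ apply ex_RInt_cont; [lra |]. intros. apply continuous_of_derive. eexists.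
        auto_derive; [sqnz | reflexivity]. }
    f_equal; apply RInt_ext; intros x _; unfold opp; simpl; field; sqnz. }
  assert (L : CInt (fun y => / ((p1 - d, y)%R - (p1, p2)))%C (p2 - d) (p2 + d) = (- (PI / 2), - A p2)).
  { unfold CInt. rewrite <- (RInt_atan p2 d Hd). unfold A.
    rewrite <- !(RInt_opp (V := R_CompleteNormedModule)).
    2,3: apply ex_RInt_cont; [lra |]; intros; apply continuous_of_derive; eexists;
        auto_derive; [sqnz | reflexivity].
    f_equal; apply RInt_ext; intros x _; unfold opp; simpl; field; sqnz. }
  rewrite B, T, L, Rr. apply C_eq; simpl; field.
Qed.

Lemma off_center (p1 p2 d : R) (z : C) : 0 < d ->
  on_bdry (p1 - d) (p1 + d) (p2 - d) (p2 + d) z -> d <= Cmod (z - (p1, p2))%C.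
Proof.
  intros Hd [Hz Hb].
  pose proof (re_le_Cmod (z - (p1, p2))%C) as H1. pose proof (Im_le_Cmod (z - (p1, p2))%C) as H2.
  simpl in H1, H2. unfold in_rect, Re, Im in *.
  destruct Hb as [E | [E | [E | E]]]; rewrite E in *.
  - eapply Rle_trans; [| apply H1]. rewrite Rabs_left1; lra.
  - eapply Rle_trans; [| apply H1]. rewrite Rabs_pos_eq; lra.
  - eapply Rle_trans; [| apply H2]. rewrite Rabs_left1; lra.
  - eapply Rle_trans; [| apply H2]. rewrite Rabs_pos_eq; lra.
Qed.

Lemma Cminus_neq_0 (a b : C) : a <> b -> (a - b)%C <> RtoC 0.
Proof.
  intros H E. apply H. replace a with ((a - b) + b)%C by ring. rewrite E. ring.
Qed.

Lemma Cauchy_formula f (p1 p2 x1 x2 y1 y2 : R) :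
  x1 < p1 < x2 -> y1 < p2 < y2 ->
  (forall z, in_rect x1 x2 y1 y2 z -> Cdiffable f z) ->
  rectI (fun z => f z * / (z - (p1, p2)))%C x1 x2 y1 y2 = (two_pi_i * f (p1, p2))%C.
Proof.
  intros Hx Hy Hf. set (p := (p1, p2) : C).
  set (g := (fun z => f z * / (z - p))%C).
  assert (Hg : forall z, in_rect x1 x2 y1 y2 z -> z <> p -> Cdiffable g z).
  { intros z Hz Hn. unfold g. cdiff; [apply Hf, Hz |]. apply Cminus_neq_0, Hn. }
  destruct (Hf p) as [l Hl]; [unfold in_rect, p; simpl; lra |].
  destruct (Hl 1 Rlt_0_1) as (d0 & Hd0 & H0).
  pose proof (Cmod_ge_0 l) as Pl.
  set (m := Rmin (Rmin (p1 - x1) (x2 - p1)) (Rmin (p2 - y1) (y2 - p2))).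
  assert (Hm : 0 < m) by (unfold m; repeat apply Rmin_pos; lra).
  assert (m <= p1 - x1 /\ m <= x2 - p1 /\ m <= p2 - y1 /\ m <= y2 - p2) as (m1 & m2 & m3 & m4).
  { unfold m. repeat split.
    - eapply Rle_trans; [apply Rmin_l | apply Rmin_l].
    - eapply Rle_trans; [apply Rmin_l | apply Rmin_r].
    - eapply Rle_trans; [apply Rmin_r | apply Rmin_l].
    - eapply Rle_trans; [apply Rmin_r | apply Rmin_r]. }
  assert (E : (rectI g x1 x2 y1 y2 - two_pi_i * f p)%C = RtoC 0).
  { apply Cmod_eq_0. apply Rle_antisym; [| apply Cmod_ge_0].
    apply le_epsilon. intros eps He. rewrite Rplus_0_l.
    (* The small square lies in the rectangle ([m]); its points are within 2d < d0 of p, where the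
       difference quotient of [f] is at most |l| + 1; and the resulting bound 16 d (|l| + 1) is at
       most eps. *)
    set (d := Rmin (Rmin m (d0 / 3)) (eps / (16 * (Cmod l + 1)))).
    assert (Hd : 0 < d).
    { unfold d. repeat apply Rmin_pos; try lra. apply Rdiv_lt_0_compat; lra. }
    assert (d1 : d <= m) by (unfold d; eapply Rle_trans; [apply Rmin_l | apply Rmin_l]).
    assert (d2 : d <= d0 / 3) by (unfold d; eapply Rle_trans; [apply Rmin_l | apply Rmin_r]).
    assert (d3 : d <= eps / (16 * (Cmod l + 1))) by (unfold d; apply Rmin_r).
    rewrite (rectI_shrink g p1 p2 d) by (auto; lra).
    assert (Nz : forall z, on_bdry (p1 - d) (p1 + d) (p2 - d) (p2 + d) z -> z <> p).
    { intros z Hz ->. apply off_center in Hz; [| lra].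
      replace (p - (p1, p2))%C with (RtoC 0) in Hz by (unfold p; apply C_eq; simpl; ring).
      rewrite Cmod_0 in Hz. lra. }
    assert (In : forall z, on_bdry (p1 - d) (p1 + d) (p2 - d) (p2 + d) z -> in_rect x1 x2 y1 y2 z).
    { intros z [Hz _]. revert Hz. unfold in_rect. lra. }
    rewrite (rectI_ext g (fun z => (f p * / (z - p)) + (f z - f p) * / (z - p))%C);
      [| lra | lra | intros z Hz; unfold g; ring].
    assert (D1 : forall z, on_bdry (p1 - d) (p1 + d) (p2 - d) (p2 + d) z ->
      Cdiffable (fun z => / (z - p))%C z).
    { intros z Hz. cdiff. apply Cminus_neq_0, Nz, Hz. }
    assert (D2 : forall z, on_bdry (p1 - d) (p1 + d) (p2 - d) (p2 + d) z ->
      Cdiffable (fun z => (f z - f p) * / (z - p))%C z).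
    { intros z Hz. cdiff. apply Hf, In, Hz. apply Cminus_neq_0, Nz, Hz. }
    rewrite rectI_plus; [| lra | lra | | exact D2].
    2:{ intros z Hz. apply Cdiffable_mult; [apply Cdiffable_const | apply D1, Hz]. }
    rewrite rectI_scal; [| lra | lra | exact D1].
    unfold p at 2. rewrite rectI_inv by lra.
    match goal with |- Cmod (?a * ?b + ?c - _)%C <= _ =>
      replace (a * b + c - b * a)%C with c by ring end.
    apply Rle_trans with (4 * (Cmod l + 1) * ((p1 + d - (p1 - d)) + (p2 + d - (p2 - d)))).
    { apply rectI_bound; [lra | lra | exact D2 |].
      intros z Hz. pose proof (Cminus_neq_0 _ _ (Nz z Hz)) as Hn.
      rewrite Cmod_mult, Cmod_inv by exact Hn. apply Cmod_gt_0 in Hn.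
      apply Rle_div_l; [exact Hn |].
      assert (Hs : Cmod (z - p)%C < d0).
      { eapply Rle_lt_trans; [apply Cmod_le_parts |]. destruct Hz as [Hz _].
        unfold in_rect, Re, Im, p in *. simpl.
        apply Rle_lt_trans with (d + d); [| lra].
        apply Rplus_le_compat; apply Rabs_le; lra. }
      specialize (H0 _ Hs). replace (p + (z - p))%C with z in H0 by ring.
      replace (f z - f p)%C with ((f z - f p - (z - p) * l) + (z - p) * l)%C by ring.
      eapply Rle_trans; [apply Cmod_triangle |]. rewrite Cmod_mult. lra. }
    apply Rle_trans with (d * (16 * (Cmod l + 1))); [right; ring |].
    apply Rle_trans with (eps / (16 * (Cmod l + 1)) * (16 * (Cmod l + 1))).
    - apply Rmult_le_compat_r; lra.
    - right; field; lra. }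
  replace (rectI g x1 x2 y1 y2)
    with ((rectI g x1 x2 y1 y2 - two_pi_i * f p) + two_pi_i * f p)%C by ring.
  rewrite E. ring.
Qed.

(** Replacing 2 PI by 6 keeps the later constants rational. *)
Lemma Cmod_2PI_le (w : C) B : Cmod (two_pi_i * w)%C <= B -> Cmod w <= B / 6.
Proof.
  intros H. rewrite Cmod_mult in H.
  assert (E : Cmod two_pi_i = 2 * PI).
  { unfold Cmod, two_pi_i. simpl. replace (0 * (0 * 1) + 2 * PI * (2 * PI * 1)) with ((2 * PI) * (2 * PI)) by ring.
    apply sqrt_square. pose proof PI_RGT_0. lra. }
  rewrite E in H. pose proof PI2_3_2. pose proof (Cmod_ge_0 w). 
  unfold PI2 in *. apply Rle_div_r; [lra |]. nra.
Qed.

Lemma square_bound f (p1 p2 r M : R) : 0 < r -> 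
  (forall z, on_bdry (p1 - r) (p1 + r) (p2 - r) (p2 + r) z -> Cdiffable f z) ->
  (forall z, on_bdry (p1 - r) (p1 + r) (p2 - r) (p2 + r) z -> Cmod (f z) <= M) ->
  Cmod (rectI f (p1 - r) (p1 + r) (p2 - r) (p2 + r)) <= 16 * M * r.
Proof.
  intros Hr H1 H2. eapply Rle_trans; [apply rectI_bound; eauto; lra |]. right. ring.
Qed.

Lemma Cauchy_bound f (p1 p2 r M : R) : 0 < r ->
  (forall z, in_rect (p1 - r) (p1 + r) (p2 - r) (p2 + r) z -> Cdiffable f z) ->
  (forall z, on_bdry (p1 - r) (p1 + r) (p2 - r) (p2 + r) z -> Cmod (f z) <= M) ->
  Cmod (f (p1, p2)) <= 4 * M.
Proof.
  intros Hr Hf HM.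
  assert (M0 : 0 <= M).
  { apply Rle_trans with (Cmod (f (p1 - r, p2))); [apply Cmod_ge_0 | apply HM; bdry]. }
  assert (Nz : forall z, on_bdry (p1 - r) (p1 + r) (p2 - r) (p2 + r) z -> (z - (p1, p2))%C <> RtoC 0).
  { intros z Hz. apply Cmod_gt_0. apply off_center in Hz; lra. }
  pose proof (Cauchy_formula f p1 p2 (p1 - r) (p1 + r) (p2 - r) (p2 + r)
    ltac:(lra) ltac:(lra) Hf) as E.
  assert (B : Cmod (two_pi_i * f (p1, p2))%C <= 16 * (M / r) * r).
  { rewrite <- E. apply square_bound; [exact Hr | |].
    - intros z Hz. cdiff; [apply Hf, Hz | apply Nz, Hz].
    - intros z Hz. rewrite Cmod_mult, Cmod_inv by (apply Nz, Hz).
      pose proof (off_center _ _ _ _ Hr Hz).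
      apply Rmult_le_compat; [apply Cmod_ge_0 | | apply HM, Hz | apply Rinv_le_contravar; lra].
      apply Rlt_le, Rinv_0_lt_compat. lra. }
  apply Cmod_2PI_le in B. replace (16 * (M / r) * r / 6) with (16 / 6 * M) in B by (field; lra).
  lra.
Qed.

(** Cauchy's formula at p and p + h, combined with 1/(z-p-h) = 1/(z-p) + h/(z-p)^2 +
    h^2/((z-p-h)(z-p)^2). The error depends on [f] only through M, which permits both termwise
    differentiation of series and the Lipschitz bound in t. *)
Lemma Cauchy_quadratic f (p : C) (r M : R) : 0 < r ->
  (forall z, in_rect (Re p - r) (Re p + r) (Im p - r) (Im p + r) z -> Cdiffable f z) ->
  (forall z, in_rect (Re p - r) (Re p + r) (Im p - r) (Im p + r) z -> Cmod (f z) <= M) ->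
  exists d, Cmod d <= 4 * M / r /\
    forall h, Cmod h <= r / 2 ->
      Cmod (f (p + h) - f p - h * d)%C <= 8 * M / r ^ 2 * Cmod h ^ 2.
Proof.
  intros Hr Hf HM. destruct p as [p1 p2]. simpl Re in *. simpl Im in *.
  set (p := (p1, p2) : C) in *.
  assert (M0 : 0 <= M).
  { apply Rle_trans with (Cmod (f p)); [apply Cmod_ge_0 | apply HM; unfold p; bdry]. }
  set (B := on_bdry (p1 - r) (p1 + r) (p2 - r) (p2 + r)).
  assert (Off : forall z, B z -> r <= Cmod (z - p)%C) by (intros z Hz; apply off_center; auto).
  assert (Nz : forall z, B z -> (z - p)%C <> RtoC 0).
  { intros z Hz. apply Cmod_gt_0. apply Off in Hz; lra. }
  assert (W : two_pi_i <> RtoC 0).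
  { intros E. apply (f_equal snd) in E. simpl in E. pose proof PI_RGT_0. lra. }
  (* The kernel of the derivative; [k3] below is the kernel of the remainder. *)
  set (k2 := (fun z => f z * (/ (z - p) * / (z - p)))%C).
  assert (Dk2 : forall z, B z -> Cdiffable k2 z).
  { intros z Hz. unfold k2. cdiff; [apply Hf, Hz | apply Nz, Hz | apply Nz, Hz]. }
  set (D := rectI k2 (p1 - r) (p1 + r) (p2 - r) (p2 + r)).
  set (d := (D / two_pi_i)%C).
  assert (Ed : (two_pi_i * d)%C = D) by (unfold d; field; exact W).
  exists d. split.
  - assert (H : Cmod (two_pi_i * d)%C <= 16 * (M / r ^ 2) * r).
    { rewrite Ed. apply square_bound; [exact Hr | exact Dk2 |].
      intros z Hz. unfold k2. rewrite !Cmod_mult, !Cmod_inv by (apply Nz, Hz).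
      specialize (Off z Hz).
      assert (I1 : / Cmod (z - p)%C <= / r) by (apply Rinv_le_contravar; lra).
      assert (I0 : 0 < / Cmod (z - p)%C) by (apply Rinv_0_lt_compat; lra).
      replace (M / r ^ 2) with (M * (/ r * / r)) by (field; lra).
      apply Rmult_le_compat; [apply Cmod_ge_0 | nra | apply HM, Hz | nra]. }
    apply Cmod_2PI_le in H.
    replace (16 * (M / r ^ 2) * r / 6) with (16 / 6 * (M / r)) in H by (field; lra).
    assert (0 <= M / r) by (apply Rdiv_le_0_compat; lra).
    replace (4 * M / r) with (4 * (M / r)) by (unfold Rdiv; ring). lra.
  - intros h Hh.
    assert (Off2 : forall z, B z -> r / 2 <= Cmod (z - (p + h))%C).
    { intros z Hz. specialize (Off z Hz). pose proof (Cmod_triangle_inv (z - p)%C h).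
      replace (z - p - h)%C with (z - (p + h))%C in H by ring. lra. }
    assert (Nz2 : forall z, B z -> (z - (p + h))%C <> RtoC 0).
    { intros z Hz. apply Cmod_gt_0. apply Off2 in Hz; lra. }
    set (k3 := (fun z => f z * (/ (z - (p + h)) * (/ (z - p) * / (z - p))))%C).
    assert (Dk3 : forall z, B z -> Cdiffable k3 z).
    { intros z Hz. unfold k3. cdiff; [apply Hf, Hz | apply Nz2, Hz | apply Nz, Hz | apply Nz, Hz]. }
    assert (Dk1 : forall z, B z -> Cdiffable (fun z => f z * / (z - p))%C z).
    { intros z Hz. cdiff; [apply Hf, Hz | apply Nz, Hz]. }
    pose proof (re_le_Cmod h) as Hh1. pose proof (Im_le_Cmod h) as Hh2.
    assert (Hh1' : Rabs (Re h) <= r / 2) by lra. assert (Hh2' : Rabs (Im h) <= r / 2) by lra.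
    apply Rabs_le_between in Hh1'. apply Rabs_le_between in Hh2'.
    pose proof (Cauchy_formula f p1 p2 (p1 - r) (p1 + r) (p2 - r) (p2 + r)
      ltac:(lra) ltac:(lra) Hf) as E1. fold p in E1.
    pose proof (Cauchy_formula f (p1 + Re h) (p2 + Im h) (p1 - r) (p1 + r) (p2 - r) (p2 + r)
      ltac:(lra) ltac:(lra) Hf) as E2.
    change (p1 + Re h, p2 + Im h) with (p + h)%C in E2.
    assert (E3 : (two_pi_i * (f (p + h) - f p - h * d))%C
      = ((h * h) * rectI k3 (p1 - r) (p1 + r) (p2 - r) (p2 + r))%C).
    { replace (two_pi_i * (f (p + h) - f p - h * d))%C
        with (two_pi_i * f (p + h)%C - two_pi_i * f p - h * (two_pi_i * d))%C by ring.
      rewrite Ed, <- E1, <- E2. unfold D.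
      rewrite (rectI_ext (fun z => f z * / (z - (p + h)))%C
        (fun z => f z * / (z - p) + (h * k2 z + (h * h) * k3 z))%C); [| lra | lra |].
      2:{ intros z Hz. unfold k2, k3. specialize (Nz z Hz). specialize (Nz2 z Hz). field. auto. }
      rewrite rectI_plus, rectI_plus, !rectI_scal; try lra; auto.
      - ring.
      - intros; apply Cdiffable_mult; [apply Cdiffable_const | auto].
      - intros; apply Cdiffable_mult; [apply Cdiffable_const | auto].
      - intros; apply Cdiffable_plus; (apply Cdiffable_mult; [apply Cdiffable_const | auto]). }
    assert (H : Cmod (two_pi_i * (f (p + h) - f p - h * d))%C
       <= Cmod h ^ 2 * (16 * (2 * M / r ^ 3) * r)).
    { rewrite E3, !Cmod_mult. replace (Cmod h * Cmod h) with (Cmod h ^ 2) by ring.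
      apply Rmult_le_compat_l; [apply pow2_ge_0 |].
      apply square_bound; [exact Hr | exact Dk3 |].
      intros z Hz. unfold k3.
      rewrite !Cmod_mult, !Cmod_inv by ((apply Nz, Hz) || (apply Nz2, Hz)).
      specialize (Off z Hz). specialize (Off2 z Hz).
      assert (I1 : / Cmod (z - p)%C <= / r) by (apply Rinv_le_contravar; lra).
      assert (I0 : 0 < / Cmod (z - p)%C) by (apply Rinv_0_lt_compat; lra).
      assert (J1 : / Cmod (z - (p + h))%C <= / (r / 2)) by (apply Rinv_le_contravar; lra).
      assert (J0 : 0 < / Cmod (z - (p + h))%C) by (apply Rinv_0_lt_compat; lra).
      replace (2 * M / r ^ 3) with (M * (/ (r / 2) * (/ r * / r))) by (field; lra).
      assert (0 < / Cmod (z - p)%C * / Cmod (z - p)%C) by nra.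
      assert (/ Cmod (z - p)%C * / Cmod (z - p)%C <= / r * / r) by nra.
      apply Rmult_le_compat; [apply Cmod_ge_0 | nra | apply HM, Hz |].
      apply Rmult_le_compat; lra. }
    apply Cmod_2PI_le in H. eapply Rle_trans; [apply H |].
    replace (Cmod h ^ 2 * (16 * (2 * M / r ^ 3) * r) / 6)
      with (32 / 6 * (M / r ^ 2 * Cmod h ^ 2)) by (field; lra).
    replace (8 * M / r ^ 2 * Cmod h ^ 2) with (8 * (M / r ^ 2 * Cmod h ^ 2)) by (field; lra).
    assert (0 <= M / r ^ 2 * Cmod h ^ 2); [| lra].
    apply Rmult_le_pos; [apply Rdiv_le_0_compat; nra | apply pow2_ge_0].
Qed.

Lemma CRcont_bounded g a b : a <= b -> (forall x, a <= x <= b -> CRcont g x) ->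
  exists M, forall x, a <= x <= b -> Cmod (g x) <= M.
Proof.
  intros Hab H.
  destruct (continuity_ab_maj (fun x => Rabs (Re (g x)) + Rabs (Im (g x))) a b Hab) as (m & Hm & _).
  - intros x Hx. destruct (H x Hx) as [H1 H2].
    apply continuity_pt_filterlim.
    apply (continuous_plus (V := R_NormedModule) (fun x => Rabs (Re (g x))) (fun x => Rabs (Im (g x))));
      apply (continuous_comp _ Rabs); auto; apply continuous_Rabs.
  - exists (Rabs (Re (g m)) + Rabs (Im (g m))). intros x Hx.
    eapply Rle_trans; [apply Cmod_le_parts | apply Hm, Hx].
Qed.

Lemma bdry_bounded f x1 x2 y1 y2 : x1 <= x2 -> y1 <= y2 ->
  (forall z, on_bdry x1 x2 y1 y2 z -> Cdiffable f z) ->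
  exists M, forall z, on_bdry x1 x2 y1 y2 z -> Cmod (f z) <= M.
Proof.
  intros Hx Hy Hf.
  destruct (CRcont_bounded (fun x => f (x, y1)) x1 x2 Hx) as [M1 H1];
    [intros; apply Cdiffable_cont_h, Hf; bdry |].
  destruct (CRcont_bounded (fun x => f (x, y2)) x1 x2 Hx) as [M2 H2];
    [intros; apply Cdiffable_cont_h, Hf; bdry |].
  destruct (CRcont_bounded (fun y => f (x1, y)) y1 y2 Hy) as [M3 H3];
    [intros; apply Cdiffable_cont_v, Hf; bdry |].
  destruct (CRcont_bounded (fun y => f (x2, y)) y1 y2 Hy) as [M4 H4];
    [intros; apply Cdiffable_cont_v, Hf; bdry |].
  exists (Rmax (Rmax M1 M2) (Rmax M3 M4)).
  intros [x y] [[Hzx Hzy] Hb]. simpl in *.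
  destruct Hb as [-> | [-> | [-> | ->]]].
  - eapply Rle_trans; [apply H3; lra |]. eapply Rle_trans; [apply Rmax_l | apply Rmax_r].
  - eapply Rle_trans; [apply H4; lra |]. eapply Rle_trans; [apply Rmax_r | apply Rmax_r].
  - eapply Rle_trans; [apply H1; lra |]. eapply Rle_trans; [apply Rmax_l | apply Rmax_l].
  - eapply Rle_trans; [apply H2; lra |]. eapply Rle_trans; [apply Rmax_r | apply Rmax_l].
Qed.

(** With q = |s0 - a| <= r / 3, the boundary of the square about s0 keeps distance at least r - q >=
    2q from a. Cauchy's bound for f(z) / (z - a)^n then gives |f(s0)| <= 4 M / 2^n for every n. *)
Lemma zero_spread f (s0 a : C) (r rho : R) : 0 < r -> 0 < rho ->
  (forall z, in_rect (Re s0 - r) (Re s0 + r) (Im s0 - r) (Im s0 + r) z -> Cdiffable f z) ->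
  (forall z, Cmod (z - a)%C < rho -> f z = RtoC 0) ->
  Cmod (s0 - a)%C <= r / 3 -> f s0 = RtoC 0.
Proof.
  intros Hr Hrho Hf Hz Hs.
  destruct (Ceq_dec s0 a) as [-> | Hne].
  { apply Hz. replace (a - a)%C with (RtoC 0) by ring. rewrite Cmod_0. exact Hrho. }
  apply Cminus_neq_0 in Hne. pose proof (proj1 (Cmod_gt_0 _) Hne) as Hq.
  set (q := Cmod (s0 - a)%C) in *.
  destruct s0 as [p1 p2]. simpl Re in *. simpl Im in *.
  destruct (bdry_bounded f (p1 - r) (p1 + r) (p2 - r) (p2 + r)) as [M HM]; try lra.
  { intros z [Hzz _]. apply Hf, Hzz. }
  assert (M0 : 0 <= M).
  { apply Rle_trans with (Cmod (f (p1 - r, p2))); [apply Cmod_ge_0 | apply HM; bdry]. }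
  assert (B : forall n, Cmod (f (p1, p2)) <= 4 * M * (1 / 2) ^ n).
  { intros n.
    pose proof (Cauchy_bound (fun z => f z * (/ (z - a)) ^ n)%C p1 p2 r (M * (/ (2 * q)) ^ n) Hr) as H.
    lapply H; [clear H; intro H |].
    (* Close to a the product is identically 0, whatever value the inverse of 0 has; elsewhere z - a
       is nonzero. *)
    2:{ intros z Hzz. destruct (Rlt_dec (Cmod (z - a)%C) rho) as [L | L].
        - exists (RtoC 0). apply Cdiff_ext_loc with (fun _ => RtoC 0); [| apply Cdiff_const].
          exists (rho - Cmod (z - a)%C). split; [lra |]. intros h Hh.
          rewrite Hz; [ring |]. replace (z + h - a)%C with ((z - a) + h)%C by ring.
          eapply Rle_lt_trans; [apply Cmod_triangle | lra].
        - cdiff; [apply Hf, Hzz |]. apply Cmod_gt_0. lra. }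
    lapply H; [clear H; intro H |].
    2:{ intros z Hzz. 
        assert (Off : 2 * q <= Cmod (z - a)%C).
        { pose proof (off_center _ _ _ _ Hr Hzz) as O.
          pose proof (Cmod_triangle_inv (z - (p1, p2))%C (- ((p1, p2) - a))%C) as T.
          rewrite Cmod_opp in T. fold q in T.
          replace (z - (p1, p2) - - ((p1, p2) - a))%C with (z - a)%C in T by ring. lra. }
        rewrite Cmod_mult, Cmod_pow, Cmod_inv by (apply Cmod_gt_0; lra).
        assert (/ Cmod (z - a)%C <= / (2 * q)) by (apply Rinv_le_contravar; lra).
        assert (0 < / Cmod (z - a)%C) by (apply Rinv_0_lt_compat; lra).
        apply Rmult_le_compat; [apply Cmod_ge_0 | apply pow_le; lra | apply HM, Hzz |].
        apply pow_incr. lra. }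
    rewrite Cmod_mult, Cmod_pow, Cmod_inv in H by exact Hne. fold q in H.
    apply (Rmult_le_compat_r (q ^ n)) in H; [| apply pow_le; lra].
    replace (Cmod (f (p1, p2)) * (/ q) ^ n * q ^ n) with (Cmod (f (p1, p2))) in H.
    2:{ rewrite Rmult_assoc, <- Rpow_mult_distr, Rinv_l, pow1 by lra. ring. }
    replace (4 * (M * (/ (2 * q)) ^ n) * q ^ n) with (4 * M * (1 / 2) ^ n) in H; [exact H |].
    replace (4 * (M * (/ (2 * q)) ^ n) * q ^ n) with (4 * M * ((/ (2 * q)) ^ n * q ^ n)) by ring.
    rewrite <- Rpow_mult_distr. do 2 f_equal. field. lra. }
  apply Cmod_eq_0. apply Rle_antisym; [| apply Cmod_ge_0].
  apply le_epsilon. intros eps He. rewrite Rplus_0_l.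
  destruct (pow_lt_1_zero (1 / 2)) with (y := eps / (4 * M + 1)) as [n Hn].
  - rewrite Rabs_pos_eq; lra.
  - apply Rdiv_lt_0_compat; lra.
  - specialize (Hn n (Nat.le_refl n)). rewrite Rabs_pos_eq in Hn by (apply pow_le; lra).
    eapply Rle_trans; [apply (B n) |].
    apply Rle_trans with ((4 * M + 1) * (1 / 2) ^ n).
    + apply Rmult_le_compat_r; [apply pow_le; lra | lra].
    + apply (Rmult_lt_compat_l (4 * M + 1)) in Hn; [| lra].
      replace ((4 * M + 1) * (eps / (4 * M + 1))) with eps in Hn by (field; lra). lra.
Qed.

(** * Series of holomorphic functions; the exponential *)

Lemma exp_monotone x y : x <= y -> exp x <= exp y.
Proof. intros [H | ->]; [apply Rlt_le, exp_increasing, H | lra]. Qed.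

Definition is_Cser (a : nat -> C) (l : C) : Prop :=
  is_series (fun n => Re (a n)) (Re l) /\ is_series (fun n => Im (a n)) (Im l).

(** Total, like [Series]; [CSer_correct] makes it the sum when a summable majorant exists. *)
Definition CSer (a : nat -> C) : C :=
  (Series (fun n => Re (a n)), Series (fun n => Im (a n))).

Lemma is_Cser_unique a l : is_Cser a l -> CSer a = l.
Proof. intros [H1 H2]. apply C_eq; apply is_series_unique; assumption. Qed.

Lemma is_Cser_ext a b l : (forall n, a n = b n) -> is_Cser a l -> is_Cser b l.
Proof.
  intros E [H1 H2]. split; [eapply is_series_ext; [| exact H1] | eapply is_series_ext; [| exact H2]];
  intros n; simpl; rewrite E; reflexivity.
Qed.

Lemma is_Cser_plus a b l m : is_Cser a l -> is_Cser b m ->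
  is_Cser (fun n => a n + b n)%C (l + m)%C.
Proof. intros [H1 H2] [H3 H4]. split; simpl; apply (is_series_plus (V := R_NormedModule)); assumption. Qed.

Lemma is_Cser_scal c a l : is_Cser a l -> is_Cser (fun n => c * a n)%C (c * l)%C.
Proof.
  intros [H1 H2]. split; simpl.
  - apply (is_series_minus (V := R_NormedModule));
      apply (is_series_scal (K := R_AbsRing) (V := R_NormedModule)); assumption.
  - apply (is_series_plus (V := R_NormedModule));
      apply (is_series_scal (K := R_AbsRing) (V := R_NormedModule)); assumption.
Qed.

Lemma CSer_correct a M : (forall n, Cmod (a n) <= M n) -> ex_series M -> is_Cser a (CSer a).
Proof.
  intros H HM. split; apply Series_correct.
  - apply (ex_series_le (V := R_CompleteNormedModule) _ M); [| exact HM].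
    intros n. eapply Rle_trans; [apply re_le_Cmod | apply H].
  - apply (ex_series_le (V := R_CompleteNormedModule) _ M); [| exact HM].
    intros n. eapply Rle_trans; [apply Im_le_Cmod | apply H].
Qed.

Lemma Rabs_Series_le a M : (forall n, Rabs (a n) <= M n) -> ex_series M ->
  Rabs (Series a) <= Series M.
Proof.
  intros H HM. eapply Rle_trans; [apply Series_Rabs |].
  - apply (ex_series_le (V := R_CompleteNormedModule) _ M); [| exact HM].
    intros n. unfold norm; simpl. unfold abs; simpl. rewrite Rabs_Rabsolu. apply H.
  - apply Series_le; [| exact HM]. intros n. split; [apply Rabs_pos | apply H].
Qed.

Lemma CSer_bound a M : (forall n, Cmod (a n) <= M n) -> ex_series M ->
  Cmod (CSer a) <= 2 * Series M.
Proof.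
  intros H HM. eapply Rle_trans; [apply Cmod_le_parts |]. simpl.
  assert (Rabs (Series (fun n => Re (a n))) <= Series M).
  { apply Rabs_Series_le; [| exact HM]. intros n. eapply Rle_trans; [apply re_le_Cmod | apply H]. }
  assert (Rabs (Series (fun n => Im (a n))) <= Series M).
  { apply Rabs_Series_le; [| exact HM]. intros n. eapply Rle_trans; [apply Im_le_Cmod | apply H]. }
  lra.
Qed.

Lemma is_series_C_parts (a : nat -> C) (l : C) :
  is_series (K := C_AbsRing) (V := C_NormedModule) a l -> is_Cser a l.
Proof.
  intros H. 
  assert (E1 : forall n, sum_n (fun k => Re (a k)) n = Re (sum_n (G := C_AbelianMonoid) a n)).
  { induction n as [| n IH]; [rewrite !sum_O; reflexivity |].
    rewrite !sum_Sn, IH. reflexivity. }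
  assert (E2 : forall n, sum_n (fun k => Im (a k)) n = Im (sum_n (G := C_AbelianMonoid) a n)).
  { induction n as [| n IH]; [rewrite !sum_O; reflexivity |].
    rewrite !sum_Sn, IH. reflexivity. }
  assert (H' : forall eps : posreal, eventually (fun n =>
     ball (M := C_UniformSpace) l eps (sum_n (G := C_AbelianMonoid) a n))).
  { apply (filterlim_locally (U := C_UniformSpace)). exact H. }
  split; apply (filterlim_locally (U := R_UniformSpace)); intros eps;
    destruct (H' eps) as [N HN]; exists N; intros n Hn; destruct (HN n Hn) as [Q1 Q2].
  - rewrite E1. exact Q1.
  - rewrite E2. exact Q2.
Qed.

(** Weierstrass's theorem at a point: the quadratic remainders of the terms have the summable
    constants 8 M n / r^2, so they add up to a quadratic remainder of the sum, whose derivative is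
    the series of derivatives. *)
Lemma Cdiffable_CSer (g : nat -> C -> C) (p : C) (r : R) (M : nat -> R) : 0 < r ->
  (forall n z, in_rect (Re p - r) (Re p + r) (Im p - r) (Im p + r) z ->
     Cdiffable (g n) z /\ Cmod (g n z) <= M n) ->
  ex_series M -> Cdiffable (fun s => CSer (fun n => g n s)) p.
Proof.
  intros Hr H HM.
  destruct (functional_choice (fun n d => Cmod d <= 4 * M n / r /\
    forall h, Cmod h <= r / 2 ->
      Cmod (g n (p + h) - g n p - h * d)%C <= 8 * M n / r ^ 2 * Cmod h ^ 2)) as [d Hd].
  { intros n. apply (Cauchy_quadratic (g n) p r (M n) Hr); intros z Hz; apply (H n z Hz). }
  assert (In : forall h, Cmod h <= r -> in_rect (Re p - r) (Re p + r) (Im p - r) (Im p + r) (p + h)%C).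
  { intros h Hh. pose proof (re_le_Cmod h) as H1. pose proof (Im_le_Cmod h) as H2.
    assert (H1' : Rabs (Re h) <= r) by lra. assert (H2' : Rabs (Im h) <= r) by lra.
    apply Rabs_le_between in H1'. apply Rabs_le_between in H2'.
    unfold in_rect. rewrite re_plus. replace (Im (p + h)%C) with (Im p + Im h) by reflexivity. lra. }
  exists (CSer d). intros eps He.
  assert (M0 : forall n, 0 <= M n).
  { intros n. eapply Rle_trans; [| apply (H n (p + RtoC 0)%C), In].
    - apply Cmod_ge_0.
    - rewrite Cmod_0; lra. }
  assert (S0 : 0 <= Series M).
  { eapply Rle_trans; [apply Rabs_pos | apply (Rabs_Series_le M M); [| exact HM]].
    intros n. rewrite Rabs_pos_eq; [lra | apply M0]. }
  set (K := 2 * (8 / r ^ 2 * Series M)).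
  assert (K0 : 0 <= K).
  { unfold K. apply Rmult_le_pos; [lra |]. apply Rmult_le_pos; [| exact S0].
    apply Rdiv_le_0_compat; [lra | apply pow_lt, Hr]. }
  exists (Rmin (r / 2) (eps / (K + 1))). split.
  { apply Rmin_pos; [lra | apply Rdiv_lt_0_compat; lra]. }
  intros h Hh.
  pose proof (Rlt_le_trans _ _ _ Hh (Rmin_l _ _)) as Hh1.
  pose proof (Rlt_le_trans _ _ _ Hh (Rmin_r _ _)) as Hh2.
  assert (C1 : is_Cser (fun n => g n (p + h)%C) (CSer (fun n => g n (p + h)%C))).
  { apply CSer_correct with M; [| exact HM]. intros n. apply H, In. lra. }
  assert (C2 : is_Cser (fun n => g n p) (CSer (fun n => g n p))).
  { apply CSer_correct with M; [| exact HM]. intros n. apply H.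
    replace p with (p + RtoC 0)%C at 5 by ring. apply In. rewrite Cmod_0. lra. }
  assert (C3 : is_Cser d (CSer d)).
  { apply CSer_correct with (fun n => 4 / r * M n).
    - intros n. replace (4 / r * M n) with (4 * M n / r) by (field; lra). apply Hd.
    - apply (ex_series_scal (K := R_AbsRing) (V := R_NormedModule)). exact HM. }
  assert (C4 : is_Cser (fun n => g n (p + h) - g n p - h * d n)%C
    (CSer (fun n => g n (p + h)%C) - CSer (fun n => g n p) - h * CSer d)%C).
  { apply is_Cser_ext with (fun n => g n (p + h) + ((-(1)) * g n p + (- h) * d n))%C;
      [intros; ring |].
    replace (CSer (fun n => g n (p + h)%C) - CSer (fun n => g n p) - h * CSer d)%C
      with (CSer (fun n => g n (p + h)%C) + ((-(1)) * CSer (fun n => g n p) + (- h) * CSer d))%C by ring.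
    apply is_Cser_plus; [exact C1 |]. apply is_Cser_plus; apply is_Cser_scal; assumption. }
  rewrite <- (is_Cser_unique _ _ C4).
  eapply Rle_trans.
  { apply (CSer_bound _ (fun n => (8 / r ^ 2 * Cmod h ^ 2) * M n)).
    - intros n. replace (8 / r ^ 2 * Cmod h ^ 2 * M n) with (8 * M n / r ^ 2 * Cmod h ^ 2) by (field; lra).
      apply Hd. lra.
    - apply (ex_series_scal (K := R_AbsRing) (V := R_NormedModule)). exact HM. }
  rewrite Series_scal_l.
  replace (2 * (8 / r ^ 2 * Cmod h ^ 2 * Series M)) with (K * Cmod h * Cmod h) by (unfold K; field; lra).
  pose proof (Cmod_ge_0 h) as h0. apply Rmult_le_compat_r; [exact h0 |].
  apply (Rmult_lt_compat_r (K + 1)) in Hh2; [| lra].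
  replace (eps / (K + 1) * (K + 1)) with eps in Hh2 by (field; lra). nra.
Qed.

(** * Complex functions of a real variable, and the complex exponential *)

Definition CRderive (g : R -> C) (x : R) (l : C) : Prop :=
  is_derive (fun y => Re (g y)) x (Re l) /\ is_derive (fun y => Im (g y)) x (Im l).

Lemma CRderive_plus g1 g2 x l m : CRderive g1 x l -> CRderive g2 x m ->
  CRderive (fun y => g1 y + g2 y)%C x (l + m)%C.
Proof. intros [H1 H2] [H3 H4]. split; simpl; apply (is_derive_plus (V := R_NormedModule)); assumption. Qed.

Lemma CRderive_scal c g x l : CRderive g x l -> CRderive (fun y => c * g y)%C x (c * l)%C.
Proof.
  intros [H1 H2]. split; simpl.
  - apply (is_derive_minus (V := R_NormedModule)); apply is_derive_scal; assumption.
  - apply (is_derive_plus (V := R_NormedModule)); apply is_derive_scal; assumption.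
Qed.

Lemma CRderive_const c x : CRderive (fun _ => c) x (RtoC 0).
Proof. split; apply (is_derive_const (K := R_AbsRing) (V := R_NormedModule)). Qed.

Lemma CRderive_RtoC x : CRderive RtoC x (RtoC 1).
Proof.
  split; [apply (is_derive_id (K := R_AbsRing)) |
          exact (is_derive_const (K := R_AbsRing) (V := R_NormedModule) 0 x)].
Qed.

Lemma CRderive_ext g1 g2 x l m : (forall y, g1 y = g2 y) -> l = m ->
  CRderive g1 x l -> CRderive g2 x m.
Proof.
  intros E <- [H1 H2]. split.
  - eapply is_derive_ext; [| exact H1]. intros; simpl; rewrite E; reflexivity.
  - eapply is_derive_ext; [| exact H2]. intros; simpl; rewrite E; reflexivity.
Qed.

Lemma CRderive_mult_id g x l : CRderive g x l ->
  CRderive (fun y => RtoC y * g y)%C x (g x + RtoC x * l)%C.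
Proof.
  intros [H1 H2]. split.
  - apply is_derive_ext with (fun y => y * Re (g y)); [intros; unfold Re, Im; simpl; ring |].
    evar (d : R). replace (Re (g x + RtoC x * l)%C) with d.
    + apply (is_derive_mult (K := R_AbsRing) (fun y => y)); [apply is_derive_id | exact H1 | apply Rmult_comm].
    + unfold d, Re, Im; simpl. unfold mult, plus, one; simpl. ring.
  - apply is_derive_ext with (fun y => y * Im (g y)); [intros; unfold Re, Im; simpl; ring |].
    evar (d : R). replace (Im (g x + RtoC x * l)%C) with d.
    + apply (is_derive_mult (K := R_AbsRing) (fun y => y)); [apply is_derive_id | exact H2 | apply Rmult_comm].
    + unfold d, Re, Im; simpl. unfold mult, plus, one; simpl. ring.
Qed.

Lemma real_MV_bound (f df : R -> R) a b M : a <= b ->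
  (forall x, a <= x <= b -> is_derive f x (df x)) ->
  (forall x, a <= x <= b -> Rabs (df x) <= M) -> Rabs (f b - f a) <= M * (b - a).
Proof.
  intros Hab H HM.
  destruct (MVT_gen f a b df) as (c & Hc & E).
  - rewrite Rmin_left, Rmax_right by lra. intros; apply H; lra.
  - rewrite Rmin_left, Rmax_right by lra. intros x Hx. apply continuity_pt_filterlim.
    apply continuous_of_derive. exists (df x). apply H, Hx.
  - rewrite Rmin_left, Rmax_right in Hc by lra.
    rewrite E, Rabs_mult, (Rabs_pos_eq (b - a)) by lra.
    apply Rmult_le_compat_r; [lra | apply HM, Hc].
Qed.

(** There is no mean value equation for complex values; the real one is applied to both parts,
    whence the factor 2. *)
Lemma CR_MV_bound (g dg : R -> C) a b M : a <= b ->
  (forall x, a <= x <= b -> CRderive g x (dg x)) ->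
  (forall x, a <= x <= b -> Cmod (dg x) <= M) -> Cmod (g b - g a)%C <= 2 * M * (b - a).
Proof.
  intros Hab H HM. eapply Rle_trans; [apply Cmod_le_parts |].
  assert (B1 := real_MV_bound (fun x => Re (g x)) (fun x => Re (dg x)) a b M Hab).
  assert (B2 := real_MV_bound (fun x => Im (g x)) (fun x => Im (dg x)) a b M Hab).
  lapply B1; [clear B1; intro B1 | intros; apply H; lra].
  lapply B2; [clear B2; intro B2 | intros; apply H; lra].
  lapply B1; [clear B1; intro B1 | intros; eapply Rle_trans; [apply re_le_Cmod | apply HM; lra]].
  lapply B2; [clear B2; intro B2 | intros; eapply Rle_trans; [apply Im_le_Cmod | apply HM; lra]].
  simpl in *. unfold Re, Im, Rminus in *. lra.
Qed.

Lemma Cexp_plus a b : Cexp (a + b)%C = (Cexp a * Cexp b)%C.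
Proof.
  destruct a as [a1 a2], b as [b1 b2]. unfold Cexp. simpl.
  rewrite exp_plus, cos_plus, sin_plus. apply C_eq; simpl; ring.
Qed.

Lemma Cexp_0 : Cexp (RtoC 0) = RtoC 1.
Proof. unfold Cexp. simpl. rewrite exp_0, cos_0, sin_0. apply C_eq; simpl; ring. Qed.

Lemma Cmod_Cexp z : Cmod (Cexp z) = exp (Re z).
Proof.
  unfold Cmod, Cexp. simpl.
  replace (exp (Re z) * cos (Im z) * (exp (Re z) * cos (Im z) * 1) +
    exp (Re z) * sin (Im z) * (exp (Re z) * sin (Im z) * 1))
    with (exp (Re z) * exp (Re z) * (Rsqr (sin (Im z)) + Rsqr (cos (Im z)))) by (unfold Rsqr; ring).
  rewrite sin2_cos2, Rmult_1_r. apply sqrt_square. apply Rlt_le, exp_pos.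
Qed.

Lemma CRderive_Cexp (c : C) (phi : R -> R) x d : is_derive phi x d ->
  CRderive (fun y => Cexp (c * RtoC (phi y)))%C x (c * RtoC d * Cexp (c * RtoC (phi x)))%C.
Proof.
  intros H. destruct c as [c1 c2].
  assert (E : ex_derive phi x) by (exists d; exact H).
  assert (U : Derive (fun y => phi y) x = d) by (apply is_derive_unique; exact H).
  split; unfold Cexp; simpl.
  - auto_derive; [repeat split; exact E |]. rewrite U. unfold Rminus. ring.
  - auto_derive; [repeat split; exact E |]. rewrite U. unfold Rminus. ring.
Qed.

(** The mean value bound is used twice on the segment y |-> h y: for exp(hy) - 1, and then for
    exp(hy) - hy, whose derivative is h (exp(hy) - 1). *)
Lemma Cexp_quadratic h : Cmod h <= 1 -> Cmod (Cexp h - RtoC 1 - h)%C <= 4 * exp 1 * Cmod h ^ 2.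
Proof.
  intros Hh. pose proof (Cmod_ge_0 h) as h0.
  assert (D : forall x, CRderive (fun y => Cexp (h * RtoC y))%C x (h * Cexp (h * RtoC x))%C).
  { intros x. eapply CRderive_ext; [| | apply (CRderive_Cexp h (fun y => y) x 1)].
    - reflexivity.
    - simpl. ring.
    - apply (is_derive_id (K := R_AbsRing)). }
  assert (B1 : forall x, 0 <= x <= 1 -> Cmod (Cexp (h * RtoC x) - RtoC 1)%C <= 2 * (Cmod h * exp 1)).
  { intros x Hx.
    pose proof (CR_MV_bound (fun y => Cexp (h * RtoC y))%C (fun y => h * Cexp (h * RtoC y))%C 0 x
      (Cmod h * exp 1) ltac:(lra)) as B.
    lapply B; [clear B; intro B | intros; apply D].
    lapply B; [clear B; intro B |].
    - rewrite Cmult_0_r, Cexp_0 in B. eapply Rle_trans; [apply B |].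
      assert (0 <= Cmod h * exp 1) by (apply Rmult_le_pos; [lra | apply Rlt_le, exp_pos]). nra.
    - intros y Hy. rewrite Cmod_mult, Cmod_Cexp. apply Rmult_le_compat_l; [lra |].
      apply exp_monotone. eapply Rle_trans; [apply Rle_abs |]. eapply Rle_trans; [apply re_le_Cmod |].
      rewrite Cmod_mult, Cmod_R, Rabs_pos_eq by lra. nra. }
  pose proof (CR_MV_bound (fun y => Cexp (h * RtoC y) + (- h) * RtoC y)%C
    (fun y => h * (Cexp (h * RtoC y) - RtoC 1))%C 0 1
      (Cmod h * (2 * (Cmod h * exp 1))) ltac:(lra)) as B.
  lapply B; [clear B; intro B |].
  - lapply B; [clear B; intro B |].
    + rewrite !Cmult_0_r, Cexp_0, !Cmult_1_r in B.
      replace (Cexp h - RtoC 1 - h)%C with (Cexp h + - h - (RtoC 1 + RtoC 0))%C by ring.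
      eapply Rle_trans; [apply B |]. right. ring.
    + intros x Hx. rewrite Cmod_mult. apply Rmult_le_compat_l; [lra | apply B1, Hx].
  - intros x Hx.
    eapply CRderive_ext; [| | apply CRderive_plus; [apply D | apply CRderive_scal, CRderive_RtoC]].
    + reflexivity.
    + simpl. ring.
Qed.

Lemma Cdiff_Cexp z : Cdiff Cexp z (Cexp z).
Proof.
  intros eps He. pose proof (exp_pos (Re z)) as P. pose proof (exp_pos 1) as P1.
  set (K := exp (Re z) * (4 * exp 1)).
  assert (HK : 0 < K) by (unfold K; nra).
  exists (Rmin 1 (eps / K)). split; [apply Rmin_pos; [lra | apply Rdiv_lt_0_compat; lra] |].
  intros h Hh.
  pose proof (Rlt_le_trans _ _ _ Hh (Rmin_l _ _)) as Hh1.
  pose proof (Rlt_le_trans _ _ _ Hh (Rmin_r _ _)) as Hh2.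
  rewrite Cexp_plus. replace (Cexp z * Cexp h - Cexp z - h * Cexp z)%C
    with (Cexp z * (Cexp h - RtoC 1 - h))%C by ring.
  rewrite Cmod_mult, Cmod_Cexp.
  apply Rle_trans with (exp (Re z) * (4 * exp 1 * Cmod h ^ 2)).
  - apply Rmult_le_compat_l; [lra | apply Cexp_quadratic; lra].
  - replace (exp (Re z) * (4 * exp 1 * Cmod h ^ 2)) with (K * Cmod h * Cmod h) by (unfold K; ring).
    apply Rmult_le_compat_r; [apply Cmod_ge_0 |].
    apply (Rmult_lt_compat_r K) in Hh2; [| lra].
    replace (eps / K * K) with eps in Hh2 by (field; lra). lra.
Qed.

(** * The trapezoid rule for powers *)

Lemma Cmod_RCpow u s : Cmod (RCpow u s) = Rpower u (Re s).
Proof.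
  unfold RCpow. rewrite Cmod_Cexp. unfold Rpower. f_equal. unfold Re; simpl. ring.
Qed.

Lemma RCpow_pred u c : 0 < u -> RCpow u (c - RtoC 1)%C = (RCpow u c * RtoC (/ u))%C.
Proof.
  intros Hu. unfold RCpow.
  replace ((c - RtoC 1) * RtoC (ln u))%C with (c * RtoC (ln u) + RtoC (- ln u))%C
    by (rewrite RtoC_opp; ring).
  rewrite Cexp_plus. f_equal. unfold Cexp. simpl.
  rewrite exp_Ropp, exp_ln, cos_0, sin_0 by exact Hu. apply C_eq; simpl; ring.
Qed.

Lemma CRderive_RCpow u c y : 0 < u + y ->
  CRderive (fun y => RCpow (u + y) c) y (c * RCpow (u + y) (c - RtoC 1))%C.
Proof.
  intros Hu. rewrite RCpow_pred by exact Hu. unfold RCpow.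
  eapply CRderive_ext; [| | apply (CRderive_Cexp c (fun y => ln (u + y)) y (/ (u + y)))].
  - reflexivity.
  - simpl. ring.
  - auto_derive; [exact Hu | ring].
Qed.

Lemma Cdiffable_RCpow u (a : C -> C) z : Cdiffable a z -> Cdiffable (fun s => RCpow u (a s)) z.
Proof.
  intros H. apply (Cdiffable_comp Cexp (fun s => a s * RtoC (ln u))%C).
  - apply Cdiffable_mult; [exact H | apply Cdiffable_const].
  - eexists. apply Cdiff_Cexp.
Qed.

Lemma Rpower_pos x y : 0 < Rpower x y.
Proof. apply exp_pos. Qed.

Lemma Rpower_neg_le u x a : 0 < u -> u <= x -> 0 <= a -> Rpower x (- a) <= Rpower u (- a).
Proof.
  intros Hu Hx Ha. apply exp_monotone.
  assert (ln u <= ln x) by (destruct Hx as [Hx | ->]; [apply Rlt_le, ln_increasing; lra | lra]).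
  nra.
Qed.

(** For Re r > 1 this is the integral of x^(-r) over [u, oo) divided by h, plus half the first term:
    the start of the Euler-Maclaurin expansion of the sum of (u + h n)^(-r). *)
Definition EM_main (h : R) (r : C) (u : R) : C :=
  (RCpow u (RtoC 1 - r) * / (RtoC h * (r - RtoC 1)) + RCpow u (- r) * RtoC (/ 2))%C.

(** The mean of the end values of x^(-r) on [u, u + h] minus its average over that interval: the
    defect of one trapezoid. *)
Definition EM_error (h : R) (r : C) (u : R) : C :=
  (RCpow u (- r) - EM_main h r u + EM_main h r (u + h))%C.

Lemma RtoC_neq_0 x : x <> 0 -> RtoC x <> RtoC 0.
Proof. intros H E. apply H. apply (f_equal fst) in E. exact E. Qed.

(** With f(y) = (u + y)^(-r) and F a primitive of f, take phi(y) = y (f(0) + f(y)) / 2 - F(y). Then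
    phi'(0) = 0 and phi''(y) = y f''(y) / 2, so two mean value bounds control phi(h) - phi(0), which
    is h times the error. The lower bound on Re r makes u^(-Re r - 2) nonincreasing, so f'' is
    largest at the left end. *)
Lemma EM_error_bound h r u : 0 < h -> 0 < u -> r <> RtoC 1 -> - 2 <= Re r ->
  Cmod (EM_error h r u)
    <= 2 * h ^ 2 * (Cmod r * Cmod (r + RtoC 1)%C * Rpower u (- (Re r + 2))).
Proof.
  intros Hh Hu Hr Hre.
  set (K := Cmod r * Cmod (r + RtoC 1)%C * Rpower u (- (Re r + 2))).
  assert (K0 : 0 <= K).
  { unfold K. pose proof (Rpower_pos u (- (Re r + 2))).
    pose proof (Cmod_ge_0 r). pose proof (Cmod_ge_0 (r + RtoC 1)%C).
    apply Rmult_le_pos; [apply Rmult_le_pos; lra | lra]. }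
  assert (Nr : (RtoC 1 - r)%C <> RtoC 0) by (apply Cminus_neq_0; auto).
  assert (Nr' : (r - RtoC 1)%C <> RtoC 0) by (apply Cminus_neq_0; auto).
  assert (Nh : RtoC h <> RtoC 0) by (apply RtoC_neq_0, Rgt_not_eq; lra).
  assert (N2 : RtoC 2 <> RtoC 0) by (apply RtoC_neq_0, Rgt_not_eq; lra).
  set (f := fun y => RCpow (u + y) (- r)%C).
  set (f1 := fun y => (- r * RCpow (u + y) (- r - RtoC 1))%C).
  set (f2 := fun y => (- r * ((- r - RtoC 1) * RCpow (u + y) (- r - RtoC 1 - RtoC 1)))%C).
  set (F := fun y => (/ (RtoC 1 - r) * RCpow (u + y) (RtoC 1 - r))%C).
  assert (DF : forall y, 0 <= y -> CRderive F y (f y)).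
  { intros y Hy. unfold F, f.
    eapply CRderive_ext; [| | apply CRderive_scal, (CRderive_RCpow u (RtoC 1 - r)%C y); lra].
    - reflexivity.
    - replace (RtoC 1 - r - RtoC 1)%C with (- r)%C by ring. field. exact Nr. }
  assert (Df : forall y, 0 <= y -> CRderive f y (f1 y)).
  { intros y Hy. unfold f, f1. apply CRderive_RCpow; lra. }
  assert (Df1 : forall y, 0 <= y -> CRderive f1 y (f2 y)).
  { intros y Hy. unfold f1, f2. apply CRderive_scal, CRderive_RCpow; lra. }
  set (phi := fun y => (/ RtoC 2 * (RtoC y * (f 0 + f y)) + (- (1)) * F y)%C).
  set (phi1 := fun y => (/ RtoC 2 * (f 0 + f y + RtoC y * f1 y) + (- (1)) * f y)%C).
  set (phi2 := fun y => (/ RtoC 2 * (RtoC y * f2 y))%C).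
  assert (Dphi : forall y, 0 <= y -> CRderive phi y (phi1 y)).
  { intros y Hy. unfold phi, phi1. apply CRderive_plus.
    - apply CRderive_scal.
      eapply CRderive_ext; [| | apply CRderive_mult_id, CRderive_plus; 
        [apply (CRderive_const (f 0)) | apply Df, Hy]]; [reflexivity | cbv beta; ring].
    - apply CRderive_scal, DF, Hy. }
  assert (Dphi1 : forall y, 0 <= y -> CRderive phi1 y (phi2 y)).
  { intros y Hy. unfold phi1, phi2.
    eapply CRderive_ext; [| | apply CRderive_plus; [apply CRderive_scal, CRderive_plus;
       [apply CRderive_plus; [apply (CRderive_const (f 0)) | apply Df, Hy] | 
        apply CRderive_mult_id, Df1, Hy] | apply CRderive_scal, Df, Hy]];
      [reflexivity | cbv beta; field; exact N2]. }
  assert (B2 : forall y, 0 <= y <= h -> Cmod (phi2 y) <= h / 2 * K).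
  { intros y Hy. unfold phi2, f2.
    rewrite !Cmod_mult, Cmod_opp, Cmod_inv, !Cmod_R, Cmod_RCpow by exact N2.
    rewrite (Rabs_pos_eq y), (Rabs_pos_eq 2) by lra.
    replace (- r - RtoC 1)%C with (- (r + RtoC 1))%C by ring. rewrite Cmod_opp.
    replace (Re (- (r + RtoC 1) - RtoC 1)%C) with (- (Re r + 2)) by (unfold Re; simpl; ring).
    assert (P : Rpower (u + y) (- (Re r + 2)) <= Rpower u (- (Re r + 2))).
    { apply Rpower_neg_le; lra. }
    pose proof (Rpower_pos (u + y) (- (Re r + 2))).
    apply Rle_trans with (/ 2 * (h * K)); [| right; field].
    apply Rmult_le_compat_l; [lra |].
    pose proof (Cmod_ge_0 r). pose proof (Cmod_ge_0 (r + RtoC 1)%C).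
    apply Rmult_le_compat; [lra | | lra |].
    - apply Rmult_le_pos; [lra | apply Rmult_le_pos; lra].
    - unfold K. rewrite <- Rmult_assoc. apply Rmult_le_compat_l; [| exact P].
      apply Rmult_le_pos; lra. }
  assert (B1 : forall y, 0 <= y <= h -> Cmod (phi1 y) <= h ^ 2 * K).
  { intros y Hy.
    pose proof (CR_MV_bound phi1 phi2 0 y (h / 2 * K) ltac:(lra)) as B.
    lapply B; [clear B; intro B | intros; apply Dphi1; lra].
    lapply B; [clear B; intro B | intros; apply B2; lra].
    replace (phi1 y) with (phi1 y - phi1 0)%C.
    - eapply Rle_trans; [apply B |].
      replace (2 * (h / 2 * K) * (y - 0)) with ((h * K) * y) by field.
      replace (h ^ 2 * K) with ((h * K) * h) by ring.
      apply Rmult_le_compat_l; [apply Rmult_le_pos; lra | lra].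
    - replace (phi1 0) with (RtoC 0); [ring |]. unfold phi1. field. }
  pose proof (CR_MV_bound phi phi1 0 h (h ^ 2 * K) ltac:(lra)) as B.
  lapply B; [clear B; intro B | intros; apply Dphi; lra].
  lapply B; [clear B; intro B | intros; apply B1; lra].
  assert (E : (phi h - phi 0 = RtoC h * EM_error h r u)%C).
  { unfold phi, EM_error, EM_main, F, f. rewrite Rplus_0_r, RtoC_inv.
    replace (RtoC 1 - r)%C with (- (r - RtoC 1))%C by ring.
    field. all: repeat split; auto. }
  rewrite E, Cmod_mult, Cmod_R, Rabs_pos_eq in B by lra.
  apply (Rmult_le_reg_l h); [lra |]. fold K. lra.
Qed.

Lemma is_lim_Rpower_neg x h tau : 0 < h -> 0 < tau ->
  is_lim_seq (fun n => Rpower (x + h * INR n) (- tau)) 0.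
Proof.
  intros Hh Ht. apply is_lim_seq_spec. intros eps.
  (* The solution of y^(-tau) = eps. *)
  set (y := exp (- ln eps / tau)).
  destruct (INR_unbounded ((y + Rabs x) / h)) as [N HN].
  exists N. intros n Hn. apply le_INR in Hn.
  assert (Hy : y < x + h * INR n).
  { apply (Rmult_gt_compat_l h) in HN; [| lra].
    replace (h * ((y + Rabs x) / h)) with (y + Rabs x) in HN by (field; lra).
    pose proof (Rle_abs (- x)). rewrite Rabs_Ropp in H. nra. }
  pose proof (exp_pos (- ln eps / tau)) as Py. fold y in Py.
  rewrite Rminus_0_r, Rabs_pos_eq by (apply Rlt_le, Rpower_pos).
  unfold Rpower. rewrite <- (exp_ln eps) by apply cond_pos. apply exp_increasing.
  apply ln_increasing in Hy; [| exact Py]. unfold y in Hy. rewrite ln_exp in Hy.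
  apply (Rmult_lt_compat_l tau) in Hy; [| exact Ht].
  replace (tau * (- ln eps / tau)) with (- ln eps) in Hy by (field; lra). lra.
Qed.

Lemma is_series_telescope (t : nat -> R) : is_lim_seq t 0 ->
  is_series (fun n => t n - t (S n)) (t O).
Proof.
  intros H. unfold is_series.
  change (is_lim_seq (sum_n (fun n => t n - t (S n))) (t O)).
  apply is_lim_seq_ext with (fun n => t O - t (S n)).
  - intros n. induction n as [| n IH]; [rewrite sum_O; reflexivity |].
    rewrite sum_Sn, <- IH. unfold plus; simpl. ring.
  - replace (Finite (t O)) with (Finite (t O - 0)) by (f_equal; ring).
    apply is_lim_seq_minus'; [apply is_lim_seq_const |].
    apply (is_lim_seq_incr_1 t). exact H.
Qed.

(** One majorant for all sums: the double sum of errors decays with exponent at least 1/4 + 2 = 2 *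
    (9/8), the single sums with exponent at least 1/4 + 1 = 5/4 > 9/8. *)
Definition pseries_term (n : nat) : R := Rpower (INR n + 1) (- (9 / 8)).

Lemma pseries_term_pos n : 0 < pseries_term n.
Proof. apply Rpower_pos. Qed.

(** Comparison with the telescoping differences of 8 x^(-1/8). The mean value theorem on [n+1, n+2]
    bounds the term at n + 2, hence the initial shift by one. *)
Lemma ex_series_pseries : ex_series pseries_term.
Proof.
  apply (ex_series_incr_1 (K := R_AbsRing) (V := R_NormedModule)).
  set (t := fun n => Rpower (1 + 1 * INR n) (- (1 / 8))).
  apply (ex_series_le (V := R_CompleteNormedModule) _ (fun n => 8 * (t n - t (S n)))).
  - intros n. unfold norm; simpl. unfold abs; simpl.
    rewrite Rabs_pos_eq by (apply Rlt_le, pseries_term_pos).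
    destruct (MVT_gen (fun x => Rpower x (- (1 / 8))) (INR n + 1) (INR n + 2)
      (fun x => - (1 / 8) * Rpower x (- (1 / 8) - 1))) as (c & Hc & E).
    + intros x Hx. rewrite Rmin_left, Rmax_right in Hx by lra.
      pose proof (pos_INR n). apply is_derive_Reals. apply derivable_pt_lim_power. lra.
    + intros x Hx. rewrite Rmin_left, Rmax_right in Hx by lra.
      pose proof (pos_INR n). apply derivable_continuous_pt.
      eexists. apply derivable_pt_lim_power. lra.
    + rewrite Rmin_left, Rmax_right in Hc by lra. pose proof (pos_INR n).
      unfold t, pseries_term. rewrite S_INR.
      replace (1 + 1 * INR n) with (INR n + 1) by ring.
      replace (1 + 1 * (INR n + 1)) with (INR n + 2) by ring.
      replace (INR n + 1 + 1) with (INR n + 2) by ring.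
      replace (- (1 / 8) - 1) with (- (9 / 8)) in E by field.
      assert (Rpower (INR n + 2) (- (9 / 8)) <= Rpower c (- (9 / 8))).
      { apply Rpower_neg_le; lra. }
      lra.
  - apply (ex_series_scal (K := R_AbsRing) (V := R_NormedModule)).
    exists (t O). apply is_series_telescope. apply is_lim_Rpower_neg; lra.
Qed.

Lemma Rpower_base_bound a u tau : 0 < a <= 1 -> a <= u -> 0 <= tau <= 5 ->
  Rpower u (- tau) <= Rpower a (- 5).
Proof.
  intros Ha Hu Ht. apply Rle_trans with (Rpower a (- tau)); [apply Rpower_neg_le; lra |].
  apply exp_monotone.
  assert (ln a <= 0).
  { rewrite <- ln_1. destruct (proj2 Ha) as [H | ->]; [apply Rlt_le, ln_increasing; lra | lra]. }
  nra.
Qed.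

Lemma Rmin3_pos a b c : 0 < a -> 0 < b -> 0 < c ->
  exists d, 0 < d <= 1 /\ d <= a /\ d <= b /\ d <= c.
Proof.
  intros. exists (Rmin (Rmin a b) (Rmin c 1)). repeat split.
  - repeat apply Rmin_pos; lra.
  - eapply Rle_trans; [apply Rmin_r | apply Rmin_r].
  - eapply Rle_trans; [apply Rmin_l | apply Rmin_l].
  - eapply Rle_trans; [apply Rmin_l | apply Rmin_r].
  - eapply Rle_trans; [apply Rmin_r | apply Rmin_l].
Qed.

(** The exponent is split as (x - 5/4) + 5/4: the first part, in [0, 5], costs a constant, and the
    second gives the decay in n uniformly in x. *)
Lemma single_term_bound a v : 0 < a -> 0 < v -> exists K, 0 <= K /\
  forall (n : nat) x, 5 / 4 <= x <= 25 / 4 -> Rpower (a + v * INR n) (- x) <= K * pseries_term n.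
Proof.
  intros Ha Hv. destruct (Rmin3_pos a v 1 Ha Hv Rlt_0_1) as (d & Hd & H1 & H2 & _).
  exists (Rpower d (- 5) * Rpower d (- (5 / 4))). split.
  { apply Rmult_le_pos; apply Rlt_le, Rpower_pos. }
  intros n x Hx. pose proof (pos_INR n) as Pn.
  replace (- x) with (- (x - 5 / 4) + - (5 / 4)) by ring. rewrite Rpower_plus, Rmult_assoc.
  apply Rmult_le_compat; try (apply Rlt_le, Rpower_pos).
  - apply Rpower_base_bound; try lra. nra.
  - apply Rle_trans with (Rpower (d * (INR n + 1)) (- (5 / 4))).
    + apply Rpower_neg_le; nra.
    + rewrite <- Rpower_mult_distr by lra. apply Rmult_le_compat_l; [apply Rlt_le, Rpower_pos |].
      apply Rle_Rpower; lra.
Qed.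

(** The variables separate by ((m+1) + (n+1))^2 >= (m+1)(n+1), raised to the power -9/8. Half of [a]
    goes to each summand 1, hence [a / 2]. *)
Lemma double_term_bound a v w : 0 < a -> 0 < v -> 0 < w -> exists K, 0 <= K /\
  forall (m n : nat) x, 9 / 4 <= x <= 29 / 4 ->
    Rpower (a + v * INR m + w * INR n) (- x) <= K * pseries_term m * pseries_term n.
Proof.
  intros Ha Hv Hw. destruct (Rmin3_pos (a / 2) v w) as (d & Hd & H1 & H2 & H3); try lra.
  exists (Rpower d (- 5) * Rpower d (- (9 / 4))). split.
  { apply Rmult_le_pos; apply Rlt_le, Rpower_pos. }
  intros m n x Hx. pose proof (pos_INR n) as Pn. pose proof (pos_INR m) as Pm.
  replace (- x) with (- (x - 9 / 4) + - (9 / 4)) by ring. rewrite Rpower_plus, !Rmult_assoc.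
  apply Rmult_le_compat; try (apply Rlt_le, Rpower_pos).
  - apply Rpower_base_bound; try lra. nra.
  - apply Rle_trans with (Rpower (d * ((INR m + 1) + (INR n + 1))) (- (9 / 4))).
    + apply Rpower_neg_le; nra.
    + rewrite <- Rpower_mult_distr by lra. apply Rmult_le_compat_l; [apply Rlt_le, Rpower_pos |].
      unfold pseries_term. rewrite Rpower_mult_distr by lra.
      replace (- (9 / 4)) with (INR 2 * (- (9 / 8))) by (simpl; field).
      rewrite <- Rpower_mult, Rpower_pow by lra.
      apply Rpower_neg_le; nra.
Qed.

(** * The continuation of the double series *)

(** Reaches beyond Re s = 2, where the double series is given; the upper bound 4 makes |s| a
    multiple of Im s at most, and Im s > 1 keeps s at distance at least 1 from the real axis. *)
Definition in_strip (s : C) : Prop := 1 / 4 < Re s < 4 /\ 1 < Im s.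

Lemma strip_square s : in_strip s -> exists r, 0 < r <= 1 /\
  forall z, in_rect (Re s - r) (Re s + r) (Im s - r) (Im s + r) z -> in_strip z.
Proof.
  intros [H1 H2].
  exists (Rmin (Rmin ((Re s - 1 / 4) / 2) ((4 - Re s) / 2)) (Rmin ((Im s - 1) / 2) 1)).
  set (r := Rmin _ _).
  assert (r <= (Re s - 1 / 4) / 2) by (unfold r; eapply Rle_trans; [apply Rmin_l | apply Rmin_l]).
  assert (r <= (4 - Re s) / 2) by (unfold r; eapply Rle_trans; [apply Rmin_l | apply Rmin_r]).
  assert (r <= (Im s - 1) / 2) by (unfold r; eapply Rle_trans; [apply Rmin_r | apply Rmin_l]).
  assert (r <= 1) by (unfold r; eapply Rle_trans; [apply Rmin_r | apply Rmin_r]).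
  split; [split; [unfold r; repeat apply Rmin_pos; lra | lra] |].
  intros z. unfold in_rect, in_strip. lra.
Qed.

Definition strip_regular (K : R) (f : C -> C) : Prop :=
  forall s, in_strip s -> Cdiffable f s /\ Cmod (f s) <= K * Im s ^ 2.

Lemma strip_regular_CSer (g : nat -> C -> C) (M : nat -> R) :
  (forall n, 0 <= M n) -> (forall n, strip_regular (M n) (g n)) -> ex_series M ->
  strip_regular (2 * Series M) (fun s => CSer (fun n => g n s)).
Proof.
  intros M0 Hg HM s Hs. split.
  - destruct (strip_square s Hs) as (r & Hr & Hin).
    (* The square about s has r <= 1, so its points have imaginary part at most Im s + 1. *)
    apply (Cdiffable_CSer g s r (fun n => (Im s + 1) ^ 2 * M n)); [lra | |].
    + intros n z Hz. destruct (Hg n z (Hin z Hz)) as [H1 H2]. split; [exact H1 |].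
      eapply Rle_trans; [exact H2 |]. rewrite Rmult_comm.
      apply Rmult_le_compat_r; [apply M0 |].
      destruct (Hin z Hz) as [_ Hi]. destruct Hz as [_ Hz].
      apply pow_incr. lra.
    + apply (ex_series_scal (K := R_AbsRing) (V := R_NormedModule)). exact HM.
  - eapply Rle_trans.
    + apply (CSer_bound _ (fun n => Im s ^ 2 * M n)).
      * intros n. rewrite Rmult_comm. apply (Hg n s Hs).
      * apply (ex_series_scal (K := R_AbsRing) (V := R_NormedModule)). exact HM.
    + rewrite Series_scal_l. right. ring.
Qed.

Lemma strip_is_Cser (g : nat -> C -> C) (M : nat -> R) s :
  (forall n, strip_regular (M n) (g n)) -> ex_series M -> in_strip s ->
  is_Cser (fun n => g n s) (CSer (fun n => g n s)).
Proof.
  intros Hg HM Hs. apply CSer_correct with (fun n => Im s ^ 2 * M n).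
  - intros n. rewrite Rmult_comm. apply (Hg n s Hs).
  - apply (ex_series_scal (K := R_AbsRing) (V := R_NormedModule)). exact HM.
Qed.

Lemma strip_regular_plus K1 K2 f g : strip_regular K1 f -> strip_regular K2 g ->
  strip_regular (K1 + K2) (fun s => f s + g s)%C.
Proof.
  intros Hf Hg s Hs. destruct (Hf s Hs) as [F1 F2], (Hg s Hs) as [G1 G2]. split.
  - apply Cdiffable_plus; assumption.
  - eapply Rle_trans; [apply Cmod_triangle | lra].
Qed.

Lemma strip_regular_mult K1 K2 f g : strip_regular K1 f ->
  (forall s, in_strip s -> Cdiffable g s /\ Cmod (g s) <= K2) ->
  strip_regular (K2 * K1) (fun s => g s * f s)%C.
Proof.
  intros Hf Hg s Hs. destruct (Hf s Hs) as [F1 F2], (Hg s Hs) as [G1 G2]. split.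
  - apply Cdiffable_mult; assumption.
  - rewrite Cmod_mult, Rmult_assoc. apply Rmult_le_compat; auto; apply Cmod_ge_0.
Qed.

Lemma im_shift_neq_0 (s c : C) : in_strip s -> Im c = 0 -> (s - c)%C <> RtoC 0.
Proof.
  intros [_ Hs] Hc E. apply (f_equal snd) in E. unfold Im in *. simpl in E. lra.
Qed.

Lemma im_shift_Cmod (s c : C) : in_strip s -> Im c = 0 -> 1 <= Cmod (s - c)%C.
Proof.
  intros [_ Hs] Hc. eapply Rle_trans; [| apply Im_le_Cmod]. unfold Im in *; simpl.
  rewrite Rabs_pos_eq; lra.
Qed.

Lemma strip_Cmod_shift s c : in_strip s -> -1 <= c <= 1 -> Cmod (s + RtoC c)%C <= 6 * Im s.
Proof.
  intros [H1 H2] Hc. eapply Rle_trans; [apply Cmod_le_parts |]. 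
  replace (Re (s + RtoC c)%C) with (Re s + c) by reflexivity.
  replace (Im (s + RtoC c)%C) with (Im s) by (unfold Im; simpl; ring).
  rewrite (Rabs_pos_eq (Im s)) by lra.
  assert (Rabs (Re s + c) <= 5) by (apply Rabs_le; lra). lra.
Qed.

(** The shift [c] serves both r = s - 1 and r = s. The constant is 72 = 2 * 6 * 6, from |r|, |r + 1|
    <= 6 Im s. *)
Lemma strip_regular_EM_error (c h u K : R) : -1 <= c <= 0 -> 0 < h -> 0 < u ->
  (forall s, in_strip s -> Rpower u (- (Re s + c + 2)) <= K) ->
  strip_regular (72 * h ^ 2 * K) (fun s => EM_error h (s + RtoC c)%C u).
Proof.
  intros Hc Hh Hu HK s Hs.
  assert (N : forall s, in_strip s -> (s + RtoC c - RtoC 1)%C <> RtoC 0).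
  { intros z Hz. replace (z + RtoC c - RtoC 1)%C with (z - RtoC (1 - c))%C.
    - apply im_shift_neq_0; [exact Hz | reflexivity].
    - rewrite RtoC_minus. ring. }
  split.
  - unfold EM_error, EM_main. cdiff; try (apply Cdiffable_RCpow; cdiff).
    + apply Cmult_neq_0; [apply RtoC_neq_0, Rgt_not_eq; lra | apply N, Hs].
    + apply Cmult_neq_0; [apply RtoC_neq_0, Rgt_not_eq; lra | apply N, Hs].
  - eapply Rle_trans.
    { apply EM_error_bound; auto.
      - intros E. apply (N s Hs). rewrite E. ring.
      - destruct Hs as [Hs _]. replace (Re (s + RtoC c)%C) with (Re s + c) by reflexivity. lra. }
    replace (Re (s + RtoC c)%C) with (Re s + c) by reflexivity.
    specialize (HK s Hs). pose proof (Rpower_pos u (- (Re s + c + 2))) as Pp.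
    pose proof (strip_Cmod_shift s c Hs ltac:(lra)) as B1.
    pose proof (strip_Cmod_shift s (c + 1) Hs ltac:(lra)) as B2.
    rewrite RtoC_plus, Cplus_assoc in B2.
    pose proof (Cmod_ge_0 (s + RtoC c)%C). pose proof (Cmod_ge_0 (s + RtoC c + RtoC 1)%C).
    replace (72 * h ^ 2 * K * Im s ^ 2) with (2 * h ^ 2 * ((6 * Im s) * (6 * Im s) * K)) by ring.
    apply Rmult_le_compat_l; [nra |].
    apply Rmult_le_compat; [apply Rmult_le_pos; lra | lra | | exact HK].
    apply Rmult_le_compat; lra.
Qed.

Lemma Rpower_bounded u y : -4 <= y <= 4 -> Rpower u y <= exp (4 * Rabs (ln u)).
Proof.
  intros Hy. apply exp_monotone. 
  pose proof (Rle_abs (ln u)). pose proof (Rle_abs (- ln u)). rewrite Rabs_Ropp in H0. nra.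
Qed.

Lemma EM_main_strip (c h u : R) : -1 <= c <= 0 -> 0 < h -> 0 < u ->
  exists K, strip_regular K (fun s => EM_main h (s + RtoC c)%C u).
Proof.
  intros Hc Hh Hu. set (L := exp (4 * Rabs (ln u))).
  assert (L0 : 0 < L) by apply exp_pos.
  exists (L * / h + L * / 2). intros s Hs.
  assert (N : (s + RtoC c - RtoC 1 = s - RtoC (1 - c))%C) by (rewrite RtoC_minus; ring).
  assert (N1 : (s + RtoC c - RtoC 1)%C <> RtoC 0).
  { rewrite N. apply im_shift_neq_0; [exact Hs | reflexivity]. }
  assert (N2 : RtoC h <> RtoC 0) by (apply RtoC_neq_0, Rgt_not_eq; lra).
  split.
  - unfold EM_main. cdiff; try (apply Cdiffable_RCpow; cdiff).
    apply Cmult_neq_0; assumption.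
  - apply Rle_trans with (L * / h + L * / 2).
    + unfold EM_main. eapply Rle_trans; [apply Cmod_triangle |].
      rewrite !Cmod_mult, !Cmod_RCpow, Cmod_inv, Cmod_mult, !Cmod_R by (apply Cmult_neq_0; assumption).
      rewrite !(Rabs_pos_eq) by lra.
      destruct Hs as [Hs1 Hs2].
      apply Rplus_le_compat; (apply Rmult_le_compat; 
        [apply Rlt_le, Rpower_pos | | apply Rpower_bounded; unfold Re in *; simpl; lra |]); try lra.
      * apply Rlt_le, Rinv_0_lt_compat, Rmult_lt_0_compat; [lra | apply Cmod_gt_0, N1].
      * apply Rinv_le_contravar; [lra |].
        assert (1 <= Cmod (s + RtoC c - RtoC 1)%C); [| nra].
        rewrite N. apply im_shift_Cmod; [split; assumption | reflexivity].
    + destruct Hs as [_ Hs]. rewrite <- (Rmult_1_r (L * / h + L * / 2)) at 1.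
      apply Rmult_le_compat_l; [| nra].
      assert (0 < / h) by (apply Rinv_0_lt_compat; lra). nra.
Qed.

Lemma is_Cser_telescope (t : nat -> C) (b : nat -> R) :
  (forall n, Cmod (t n) <= b n) -> is_lim_seq b 0 ->
  is_Cser (fun n => t n - t (S n))%C (t O).
Proof.
  intros H Hb.
  split.
  - apply (is_series_telescope (fun n => Re (t n))).
    apply is_lim_seq_abs_0. apply (is_lim_seq_le_le (fun _ => 0) _ b).
    + intros n. split; [apply Rabs_pos | eapply Rle_trans; [apply re_le_Cmod | apply H]].
    + apply is_lim_seq_const.
    + exact Hb.
  - apply (is_series_telescope (fun n => Im (t n))).
    apply is_lim_seq_abs_0. apply (is_lim_seq_le_le (fun _ => 0) _ b).
    + intros n. split; [apply Rabs_pos | eapply Rle_trans; [apply Im_le_Cmod | apply H]].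
    + apply is_lim_seq_const.
    + exact Hb.
Qed.

(** The terms [EM_main] telescope down to the first one, because Re r > 1 makes them tend to 0. *)
Lemma EM_summation (h x : R) (r l : C) : 0 < h -> 0 < x -> 1 < Re r ->
  is_Cser (fun n => EM_error h r (x + h * INR n)) l ->
  is_Cser (fun n => RCpow (x + h * INR n) (- r)%C) (EM_main h r x + l)%C.
Proof.
  intros Hh Hx Hr Hl.
  set (t := fun n => EM_main h r (x + h * INR n)).
  assert (T : is_Cser (fun n => t n - t (S n))%C (t O)).
  { set (c := Cmod (/ (RtoC h * (r - RtoC 1)))%C).
    apply is_Cser_telescope with
      (fun n => Rpower (x + h * INR n) (- (Re r - 1)) * c + Rpower (x + h * INR n) (- Re r) * / 2).
    - intros n. unfold t, EM_main. eapply Rle_trans; [apply Cmod_triangle |].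
      rewrite !Cmod_mult, !Cmod_RCpow, Cmod_R, (Rabs_pos_eq (/ 2)) by lra. fold c.
      replace (Re (RtoC 1 - r)%C) with (- (Re r - 1)) by (unfold Re; simpl; ring).
      rewrite re_opp. lra.
    - replace (Finite 0) with (Finite (0 * c + 0 * / 2)) by (f_equal; ring).
      apply is_lim_seq_plus';
        (apply (is_lim_seq_mult' _ (fun _ => _)); [| apply is_lim_seq_const]);
        apply is_lim_Rpower_neg; lra. }
  replace (t O) with (EM_main h r x) in T.
  2:{ unfold t. f_equal. simpl. ring. }
  apply is_Cser_ext with (fun n => (t n - t (S n)) + EM_error h r (x + h * INR n))%C.
  - intros n. unfold t, EM_error. rewrite S_INR.
    replace (x + h * (INR n + 1)) with (x + h * INR n + h) by ring. ring.
  - apply is_Cser_plus; assumption.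
Qed.

Lemma ex_series_double K :
  ex_series (fun m => 2 * Series (fun n => K * pseries_term m * pseries_term n)).
Proof.
  apply ex_series_ext with (fun m => 2 * K * Series pseries_term * pseries_term m).
  - intros m. assert (E : 2 * K * Series pseries_term * pseries_term m =
      2 * Series (fun n => K * pseries_term m * pseries_term n)) by (rewrite Series_scal_l; ring).
    exact E.
  - apply (ex_series_scal (K := R_AbsRing) (V := R_NormedModule)). apply ex_series_pseries.
Qed.

Section Continuation.

Variables alpha v w : R.
Hypotheses (Ha : 0 < alpha) (Hv : 0 < v) (Hw : 0 < w).

Let err1 (n : nat) (s : C) : C := EM_error v (s + RtoC (-1))%C (alpha + v * INR n).
Let err0 (n : nat) (s : C) : C := EM_error v (s + RtoC 0)%C (alpha + v * INR n).
Let err2 (m n : nat) (s : C) : C := EM_error w (s + RtoC 0)%C (alpha + v * INR m + w * INR n).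

(** Summing over n leaves (alpha + v m)^(1-s) / (w (s-1)) + (alpha + v m)^(-s) / 2 plus errors. The
    first two lines are these powers summed over m by the same rule, with r = s - 1 and r = s; the
    last line collects the errors of the inner sums. *)
Definition barnes_continuation (s : C) : C :=
  (/ (RtoC w * (s - RtoC 1)) *
     (EM_main v (s + RtoC (-1)) alpha + CSer (fun n => err1 n s))
   + RtoC (/ 2) * (EM_main v (s + RtoC 0) alpha + CSer (fun n => err0 n s))
   + CSer (fun m => CSer (fun n => err2 m n s)))%C.

Lemma single_regular c : -1 <= c <= 0 -> exists M, (forall n, 0 <= M n) /\ ex_series M /\
  forall n, strip_regular (M n) (fun s => EM_error v (s + RtoC c)%C (alpha + v * INR n)).
Proof.
  intros Hc. destruct (single_term_bound alpha v Ha Hv) as (K & K0 & HK).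
  exists (fun n => 72 * v ^ 2 * K * pseries_term n).
  assert (P : 0 <= 72 * v ^ 2 * K) by (apply Rmult_le_pos; nra).
  split; [| split].
  - intros n. apply Rmult_le_pos; [exact P | apply Rlt_le, pseries_term_pos].
  - apply (ex_series_scal (K := R_AbsRing) (V := R_NormedModule)). apply ex_series_pseries.
  - intros n. rewrite Rmult_assoc. pose proof (pos_INR n).
    apply strip_regular_EM_error; auto; [nra |].
    intros s [Hs _]. apply HK. lra.
Qed.

Lemma double_regular : exists K, 0 <= K /\
  forall m n, strip_regular (K * pseries_term m * pseries_term n) (err2 m n).
Proof.
  destruct (double_term_bound alpha v w Ha Hv Hw) as (K & K0 & HK).
  exists (72 * w ^ 2 * K). split; [apply Rmult_le_pos; nra |].
  intros m n. rewrite !Rmult_assoc, <- (Rmult_assoc 72), <- (Rmult_assoc K).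
  pose proof (pos_INR n). pose proof (pos_INR m).
  apply strip_regular_EM_error; [lra | lra | nra |].
  intros s [Hs _]. apply HK. lra.
Qed.

Lemma barnes_continuation_regular : exists K, strip_regular K barnes_continuation.
Proof.
  destruct (single_regular (-1) ltac:(lra)) as (M1 & P1 & S1 & R1).
  destruct (single_regular 0 ltac:(lra)) as (M0 & P0 & S0 & R0).
  destruct double_regular as (K & K0 & R2).
  destruct (EM_main_strip (-1) v alpha ltac:(lra) Hv Ha) as (L1 & HL1).
  destruct (EM_main_strip 0 v alpha ltac:(lra) Hv Ha) as (L0 & HL0).
  eexists. unfold barnes_continuation.
  apply strip_regular_plus; [apply strip_regular_plus; apply strip_regular_mult |].
  - apply strip_regular_plus; [exact HL1 |].
    apply (strip_regular_CSer err1 M1); assumption.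
  (* On the strip |s - 1| >= 1, so the coefficient 1 / (w (s - 1)) is at most 1 / w. *)
  - instantiate (1 := / w). intros s Hs.
    pose proof (im_shift_neq_0 s (RtoC 1) Hs eq_refl) as N.
    assert (Nw : RtoC w <> RtoC 0) by (apply RtoC_neq_0, Rgt_not_eq; lra).
    split.
    + cdiff. apply Cmult_neq_0; assumption.
    + rewrite Cmod_inv, Cmod_mult, Cmod_R, Rabs_pos_eq by (lra || apply Cmult_neq_0; assumption).
      apply Rinv_le_contravar; [lra |].
      pose proof (im_shift_Cmod s (RtoC 1) Hs eq_refl). nra.
  - apply strip_regular_plus; [exact HL0 |].
    apply (strip_regular_CSer err0 M0); assumption.
  - instantiate (1 := / 2). intros s Hs. split; [apply Cdiffable_const |].
    rewrite Cmod_R, Rabs_pos_eq; lra.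
  - apply (strip_regular_CSer (fun m s => CSer (fun n => err2 m n s))
      (fun m => 2 * Series (fun n => K * pseries_term m * pseries_term n))).
    + intros m. rewrite Series_scal_l. 
      pose proof (pseries_term_pos m).
      assert (0 <= Series pseries_term).
      { eapply Rle_trans; [apply Rabs_pos | apply (Rabs_Series_le pseries_term pseries_term)].
        - intros n. rewrite Rabs_pos_eq; [lra | apply Rlt_le, pseries_term_pos].
        - apply ex_series_pseries. }
      repeat apply Rmult_le_pos; lra.
    + intros m. apply strip_regular_CSer.
      * intros n. pose proof (pseries_term_pos m). pose proof (pseries_term_pos n).
        repeat apply Rmult_le_pos; lra.
      * intros n. apply R2.
      * apply (ex_series_scal (K := R_AbsRing) (V := R_NormedModule)). apply ex_series_pseries.
    + apply ex_series_double.
Qed.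

Lemma barnes_continuation_series s l : in_strip s -> 2 < Re s ->
  is_double_series (fun m n => RCpow (alpha + v * INR m + w * INR n) (- s)%C) l ->
  l = barnes_continuation s.
Proof.
  intros Hs H2 (r & Hr & Hl).
  destruct (single_regular (-1) ltac:(lra)) as (M1 & P1 & S1 & R1).
  destruct (single_regular 0 ltac:(lra)) as (M0 & P0 & S0 & R0).
  destruct double_regular as (K & K0 & R2).
  pose proof (im_shift_neq_0 s (RtoC 1) Hs eq_refl) as N.
  assert (Nw : RtoC w <> RtoC 0) by (apply RtoC_neq_0, Rgt_not_eq; lra).
  assert (E0 : (s + RtoC 0 = s)%C) by ring.
  assert (E1 : (s + RtoC (-1) = s - RtoC 1)%C).
  { replace (RtoC (-1)) with (- RtoC 1)%C by (rewrite <- RtoC_opp; f_equal; ring). ring. }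
  (* The inner sums, evaluated with step w. *)
  assert (Er : forall m, r m = (EM_main w s (alpha + v * INR m) + CSer (fun n => err2 m n s))%C).
  { intros m. pose proof (is_series_C_parts _ _ (Hr m)) as H.
    apply is_Cser_unique in H. rewrite <- H. apply is_Cser_unique.
    pose proof (pos_INR m).
    apply EM_summation; [exact Hw | nra | lra |].
    apply is_Cser_ext with (fun n => err2 m n s).
    - intros n. unfold err2. rewrite E0. reflexivity.
    - apply (strip_is_Cser (err2 m) (fun n => K * pseries_term m * pseries_term n)).
      + intros n. apply R2.
      + apply (ex_series_scal (K := R_AbsRing) (V := R_NormedModule)). apply ex_series_pseries.
      + exact Hs. }
  apply is_series_C_parts in Hl. apply is_Cser_unique in Hl. rewrite <- Hl.
  apply is_Cser_unique.
  apply is_Cser_ext with (fun m => / (RtoC w * (s - RtoC 1)) * RCpow (alpha + v * INR m) (- (s - RtoC 1))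
    + RtoC (/ 2) * RCpow (alpha + v * INR m) (- s) + CSer (fun n => err2 m n s))%C.
  { intros m. rewrite Er. unfold EM_main. 
    replace (RtoC 1 - s)%C with (- (s - RtoC 1))%C by ring. ring. }
  unfold barnes_continuation. apply is_Cser_plus; [apply is_Cser_plus; apply is_Cser_scal |].
  (* Here the exponent is s - 1, so convergence uses Re s > 2 in full. *)
  - rewrite E1. apply EM_summation; [exact Hv | exact Ha | unfold Re in *; simpl; lra |].
    apply is_Cser_ext with (fun n => err1 n s).
    + intros n. unfold err1. rewrite E1. reflexivity.
    + apply (strip_is_Cser err1 M1); assumption.
  - rewrite E0. apply EM_summation; [exact Hv | exact Ha | lra |].
    apply is_Cser_ext with (fun n => err0 n s).
    + intros n. unfold err0. rewrite E0. reflexivity.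
    + apply (strip_is_Cser err0 M0); assumption.
  - apply (strip_is_Cser (fun m s => CSer (fun n => err2 m n s))
      (fun m => 2 * Series (fun n => K * pseries_term m * pseries_term n))); [| | exact Hs].
    + intros m. apply strip_regular_CSer.
      * intros n. pose proof (pseries_term_pos m). pose proof (pseries_term_pos n).
        repeat apply Rmult_le_pos; lra.
      * intros n. apply R2.
      * apply (ex_series_scal (K := R_AbsRing) (V := R_NormedModule)). apply ex_series_pseries.
    + apply ex_series_double.
Qed.

End Continuation.

(** * Uniqueness of the continuation *)

Lemma ex_derive_Cdiffable (f : C -> C) z :
  ex_derive (K := C_AbsRing) (V := C_NormedModule) f z -> Cdiffable f z.
Proof.
  intros [l [_ H]]. exists l. intros eps He.
  destruct (H z (fun P HP => HP) (mkposreal eps He)) as [d Hd].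
  exists d. split; [apply cond_pos |]. intros h Hh.
  specialize (Hd (z + h)%C).
  assert (B : ball (M := AbsRing_UniformSpace C_AbsRing) z d (z + h)%C).
  { change (Cmod (minus (G := C_AbelianGroup) (z + h)%C z) < d).
    replace (minus (G := C_AbelianGroup) (z + h)%C z) with h; [exact Hh |].
    change (h = (z + h - z)%C). ring. }
  specialize (Hd B).
  change (Cmod (f (z + h) - f z - (z + h - z) * l)%C <= eps * Cmod (z + h - z)%C) in Hd.
  replace (z + h - z)%C with h in Hd by ring. exact Hd.
Qed.

(** Balls of [C_UniformSpace] are open squares, taken coordinatewise, so they contain the disc of
    the same radius. *)
Lemma Cmod_lt_ball (z0 z : C) (d : R) : Cmod (z - z0)%C < d ->
  ball (M := C_UniformSpace) z0 d z.
Proof.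
  intros H. pose proof (re_le_Cmod (z - z0)%C) as H1. pose proof (Im_le_Cmod (z - z0)%C) as H2.
  split.
  - change (Rabs (Re (z - z0)%C) < d). lra.
  - change (Rabs (Im (z - z0)%C) < d). lra.
Qed.

Lemma holomorphic_at_Cdiffable f z0 : holomorphic_at f z0 ->
  exists r, 0 < r /\ forall z, Cmod (z - z0)%C < r -> Cdiffable f z.
Proof.
  intros [d Hd]. exists d. split; [apply cond_pos |].
  intros z Hz. apply ex_derive_Cdiffable, Hd, Cmod_lt_ball, Hz.
Qed.

(** Puts both cases of meromorphy in one form, with n = 0 at a holomorphic point. The identity
    leaves out z0, since the value at a pole is arbitrary. *)
Lemma meromorphic_local f z0 : meromorphic f -> exists r n g, 0 < r /\
  (forall z, Cmod (z - z0)%C < r -> Cdiffable g z) /\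
  (forall z, Cmod (z - z0)%C < r -> z <> z0 -> (f z * (z - z0) ^ n)%C = g z) /\
  (n = O /\ f z0 = g z0 \/ (1 <= n)%nat /\ g z0 <> RtoC 0).
Proof.
  intros H. destruct (H z0) as [Hh | (n & g & Hn & Hg & Hg0 & [d Hd])].
  - destruct (holomorphic_at_Cdiffable f z0 Hh) as (r & Hr & Hf).
    exists r, O, f. repeat split; auto.
    intros z _ _. simpl. ring.
  - destruct (holomorphic_at_Cdiffable g z0 Hg) as (r & Hr & Hf).
    exists (Rmin r d), n, g. split; [apply Rmin_pos; [exact Hr | apply cond_pos] |].
    split; [| split].
    + intros z Hz. apply Hf. eapply Rlt_le_trans; [exact Hz | apply Rmin_l].
    + intros z Hz Hne. rewrite Hd.
      * field. apply Cpow_nz, Cminus_neq_0, Hne.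
      * apply Cmod_lt_ball. eapply Rlt_le_trans; [exact Hz | apply Rmin_r].
      * exact Hne.
    + right. split; assumption.
Qed.

Definition zero_near (f : C -> C) (a : C) : Prop :=
  exists rho, 0 < rho /\ forall z, Cmod (z - a)%C < rho -> f z = RtoC 0.

Lemma in_rect_Cmod (p z : C) r :
  in_rect (Re p - r) (Re p + r) (Im p - r) (Im p + r) z -> Cmod (z - p)%C <= 2 * r.
Proof.
  intros [H1 H2]. eapply Rle_trans; [apply Cmod_le_parts |].
  change (Rabs (Re z - Re p) + Rabs (Im z - Im p) <= 2 * r).
  assert (Rabs (Re z - Re p) <= r) by (apply Rabs_le; lra).
  assert (Rabs (Im z - Im p) <= r) by (apply Rabs_le; lra). lra.
Qed.

Lemma Cmod_in_rect (p z : C) r : Cmod (z - p)%C <= r ->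
  in_rect (Re p - r) (Re p + r) (Im p - r) (Im p + r) z.
Proof.
  intros H. pose proof (re_le_Cmod (z - p)%C) as H1. pose proof (Im_le_Cmod (z - p)%C) as H2.
  assert (H1' : Rabs (Re z - Re p) <= r) by (change (Rabs (Re (z - p)%C) <= r); lra).
  assert (H2' : Rabs (Im z - Im p) <= r) by (change (Rabs (Im (z - p)%C) <= r); lra).
  apply Rabs_le_between in H1'. apply Rabs_le_between in H2'. unfold in_rect. lra.
Qed.

Lemma Cmod_dist_triangle (a b c : C) : Cmod (a - c)%C <= Cmod (a - b)%C + Cmod (b - c)%C.
Proof.
  replace (a - c)%C with ((a - b) + (b - c))%C by ring. apply Cmod_triangle.
Qed.

(* A pole of [f] at [c] is excluded here: the numerator would vanish near, hence at, [c]. *)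
Lemma zero_near_local (f G : C -> C) (c : C) (r : R) : meromorphic f -> 0 < r ->
  (forall z, Cmod (z - c)%C < r -> Cdiffable G z) ->
  exists r1, 0 < r1 /\ forall a b, Cmod (a - c)%C < r1 -> Cmod (b - c)%C < r1 ->
    zero_near (fun z => f z - G z)%C a -> zero_near (fun z => f z - G z)%C b.
Proof.
  intros Hmer Hr HG.
  destruct (meromorphic_local f c Hmer) as (r0 & n & g & Hr0 & Hg & Hfg & Hn).
  (* [zero_spread] will be used at points s within 2q of c, with centre a0 within 2q of c and a
     square of half side 12q: then |s - a0| <= 4q = 12q / 3, and the square stays within 26q of
     c. *)
  set (q := Rmin r r0 / 32).
  assert (Hq : 0 < q) by (unfold q; pose proof (Rmin_pos r r0 Hr Hr0); lra).
  assert (Hqr : 32 * q <= r) by (unfold q; pose proof (Rmin_l r r0); lra).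
  assert (Hqr0 : 32 * q <= r0) by (unfold q; pose proof (Rmin_r r r0); lra).
  exists q. split; [exact Hq |]. intros a b Ha Hb (rho & Hrho & Hz).
  set (k := (fun z => g z - G z * (z - c) ^ n)%C).
  assert (Hk : forall z, Cmod (z - c)%C < r0 -> z <> c -> k z = ((f z - G z) * (z - c) ^ n)%C).
  { intros z Hz1 Hz2. unfold k. rewrite <- Hfg by assumption. ring. }
  (* A smaller disc on which f = G and which misses c, as the formula for [k] fails at c when c is a
     pole. *)
  assert (Hsub : exists a0 rho0, 0 < rho0 <= q /\ Cmod (a0 - c)%C <= 2 * q /\
    forall z, Cmod (z - a0)%C < rho0 -> z <> c /\ Cmod (z - a)%C < rho).
  { destruct (Ceq_dec a c) as [-> | Hne].
    - set (e := Rmin rho q / 2).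
      assert (He : 0 < e) by (unfold e; pose proof (Rmin_pos rho q Hrho Hq); lra).
      assert (2 * e <= rho) by (unfold e; pose proof (Rmin_l rho q); lra).
      assert (2 * e <= q) by (unfold e; pose proof (Rmin_r rho q); lra).
      assert (E : Cmod (c + RtoC e - c)%C = e).
      { replace (c + RtoC e - c)%C with (RtoC e) by ring. rewrite Cmod_R. apply Rabs_pos_eq. lra. }
      exists (c + RtoC e)%C, e. split; [lra |]. split; [lra |].
      intros z Hz1. split.
      + intros ->. rewrite Cmod_minus_sym in Hz1. lra.
      + pose proof (Cmod_dist_triangle z (c + RtoC e)%C c). lra.
    - pose proof (proj1 (Cmod_gt_0 _) (Cminus_neq_0 _ _ Hne)) as Hac.
      exists a, (Rmin (Cmod (a - c)%C) rho). split; [split |].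
      + apply Rmin_pos; assumption.
      + eapply Rle_trans; [apply Rmin_l | lra].
      + split; [lra |]. intros z Hz1. split.
        * intros ->. rewrite Cmod_minus_sym in Hz1. pose proof (Rmin_l (Cmod (a - c)%C) rho). lra.
        * eapply Rlt_le_trans; [exact Hz1 | apply Rmin_r]. }
  destruct Hsub as (a0 & rho0 & Hrho0 & Ha0 & Hball).
  assert (Hk0 : forall s, Cmod (s - c)%C < 2 * q -> k s = RtoC 0).
  { intros s Hs. apply (zero_spread k s a0 (12 * q) rho0); [lra | lra | | |].
    - intros z Hz1. apply in_rect_Cmod in Hz1. pose proof (Cmod_dist_triangle z s c).
      unfold k. cdiff; [apply Hg | apply HG]; lra.
    - intros z Hz1. destruct (Hball z Hz1) as [N1 N2].
      pose proof (Cmod_dist_triangle z a0 c).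
      rewrite Hk; [| lra | exact N1]. rewrite (Hz z N2). ring.
    - pose proof (Cmod_dist_triangle s c a0). rewrite (Cmod_minus_sym c a0) in H. lra. }
  destruct Hn as [[-> E] | [Hn Hgc]].
  - exists q. split; [exact Hq |]. intros z Hz1.
    pose proof (Cmod_dist_triangle z b c).
    specialize (Hk0 z ltac:(lra)).
    destruct (Ceq_dec z c) as [-> | Hne].
    + rewrite E, <- Hk0. unfold k. simpl. ring.
    + rewrite Hk in Hk0; [| lra | exact Hne]. rewrite <- Hk0. simpl. ring.
  - exfalso. apply Hgc. rewrite <- (Hk0 c).
    + unfold k. replace (c - c)%C with (RtoC 0) by ring.
      destruct n as [| n]; [lia |]. rewrite Cpow_S. ring.
    + replace (c - c)%C with (RtoC 0) by ring. rewrite Cmod_0. lra.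
Qed.

(** Connectedness of the segment: near every point the truth value of P is constant, and the
    supremum of the lengths to the left of b on which P holds cannot stop short of a. *)
Lemma segment_propagation (P : R -> Prop) a b : a <= b ->
  (forall c, a <= c <= b -> exists r, 0 < r /\
     forall x y, Rabs (x - c) < r -> Rabs (y - c) < r -> P x -> P y) ->
  P b -> P a.
Proof.
  intros Hab Hloc Hb.
  destruct (completeness (fun x => 0 <= x <= b - a /\ forall y, 0 <= y <= x -> P (b - y))) as [m [M1 M2]].
  - exists (b - a). intros x [Hx _]. lra.
  - exists 0. split; [lra |]. intros y Hy. replace (b - y) with b by lra. exact Hb.
  - assert (Hm : 0 <= m <= b - a).
    { split.
      - apply M1. split; [lra |]. intros y Hy. replace (b - y) with b by lra. exact Hb.
      - apply M2. intros x [Hx _]. lra. }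
    destruct (Hloc (b - m) ltac:(lra)) as (r & Hr & Hc).
    assert (exists x, (0 <= x <= b - a /\ forall y, 0 <= y <= x -> P (b - y)) /\ m - r < x) as (x & [Hx1 Hx2] & Hx3).
    { apply NNPP. intros Hno. assert (m <= m - r); [| lra].
      apply M2. intros x Hx. apply Rnot_lt_le. intros L. apply Hno. exists x. auto. }
    assert (x <= m) by (apply M1; split; assumption).
    assert (Pc : forall y, Rabs (y - (b - m)) < r -> P y).
    { intros y Hy. apply (Hc (b - x)); auto.
      - apply Rabs_def1; lra.
      - apply Hx2; lra. }
    destruct (Rle_lt_or_eq_dec m (b - a) (proj2 Hm)) as [L | E].
    + exfalso. set (x' := Rmin (m + r / 2) (b - a)).
      assert (x' <= m + r / 2) by apply Rmin_l. assert (x' <= b - a) by apply Rmin_r.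
      assert (m < x') by (unfold x'; apply Rmin_glb_lt; lra).
      assert (x' <= m); [| lra].
      apply M1. split; [lra |]. intros y Hy.
      destruct (Rle_dec y x) as [Q | Q]; [apply Hx2; lra |].
      apply Pc. apply Rabs_def1; lra.
    + apply Pc. rewrite E. replace (a - (b - (b - a))) with 0 by ring. rewrite Rabs_R0. exact Hr.
Qed.

Lemma identity_on_strip (f G : C -> C) : meromorphic f ->
  (forall s, in_strip s -> Cdiffable G s) ->
  (forall s, in_strip s -> 2 < Re s -> f s = G s) ->
  forall s, in_strip s -> f s = G s.
Proof.
  intros Hmer HG Heq s Hs.
  destruct (Rlt_dec 2 (Re s)) as [L | L]; [apply Heq; assumption |].
  destruct s as [x0 t]. destruct Hs as [Hx Ht]. simpl in Hx, Ht, L.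
  assert (Z : zero_near (fun z => f z - G z)%C (x0, t)).
  { apply (segment_propagation (fun x => zero_near (fun z => f z - G z)%C (x, t)) x0 3); [lra | |].
    - intros c Hc.
      destruct (strip_square (c, t)) as (r & Hr & Hin).
      { split; simpl; lra. }
      destruct (zero_near_local f G (c, t) r Hmer ltac:(lra)) as (r1 & Hr1 & Hl).
      { intros z Hz. apply HG, Hin, Cmod_in_rect. lra. }
      assert (Hd : forall x, Cmod ((x, t) - (c, t))%C = Rabs (x - c)).
      { intros x. rewrite <- Cmod_R. f_equal. apply C_eq; simpl; ring. }
      exists r1. split; [exact Hr1 |]. intros x y Hx1 Hy1.
      apply Hl; rewrite Hd; assumption.
    - destruct (strip_square (3, t)) as (r & Hr & Hin).
      { split; simpl; lra. }
      exists (Rmin r 1). split; [apply Rmin_pos; lra |]. intros z Hz.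
      pose proof (Rlt_le_trans _ _ _ Hz (Rmin_l _ _)) as Z1.
      pose proof (Rlt_le_trans _ _ _ Hz (Rmin_r _ _)) as Z2.
      rewrite Heq; [ring | |].
      + apply Hin, Cmod_in_rect. lra.
      + pose proof (Cmod_in_rect (3, t) z (Cmod (z - (3, t))%C) ltac:(lra)) as [[Q _] _].
        simpl in Q. unfold Re in *. lra. }
  destruct Z as (rho & Hrho & Z).
  specialize (Z (x0, t)).
  replace (f (x0, t)) with ((f (x0, t) - G (x0, t)) + G (x0, t))%C by ring.
  rewrite Z; [ring |]. replace ((x0, t) - (x0, t))%C with (RtoC 0) by (apply C_eq; simpl; ring).
  rewrite Cmod_0. exact Hrho.
Qed.

(** * Growth and moments *)

Lemma strip_regular_growth (K : R) (f : C -> C) : strip_regular K f ->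
  exists L, 0 < L /\
    forall sigma t, 1 / 2 <= sigma <= 2 -> 2 <= t ->
      Cmod (f (sigma, t)) <= L * t ^ 2 /\
      forall h, Rabs h <= 1 / 16 ->
        Rabs (Cmod (f (sigma, (t + h)%R)) - Cmod (f (sigma, t))) <= L * t ^ 2 * Rabs h.
Proof.
  intros Hf. exists (256 * Rabs K + 1).
  pose proof (Rabs_pos K) as K0. pose proof (Rle_abs K) as K1.
  split; [lra |]. intros sigma t Hs Ht.
  assert (Hsq : forall z, in_rect (sigma - 1 / 8) (sigma + 1 / 8) (t - 1 / 8) (t + 1 / 8) z ->
     in_strip z /\ Im z <= 2 * t) by (intros z; unfold in_rect, in_strip; lra).
  split.
  - destruct (Hf (sigma, t)) as [_ B]; [unfold in_strip; simpl; lra |].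
    change (Im (sigma, t)) with t in B. eapply Rle_trans; [exact B |].
    apply Rmult_le_compat_r; [apply pow2_ge_0 | lra].
  - intros h Hh.
    destruct (Cauchy_quadratic f (sigma, t) (1 / 8) (Rabs K * (2 * t) ^ 2)) as (d & Hd1 & Hd2).
    + lra.
    + intros z Hz. apply Hf, Hsq, Hz.
    + intros z Hz. destruct (Hsq z Hz) as [Q1 Q2]. destruct (Hf z Q1) as [_ B].
      eapply Rle_trans; [exact B |]. destruct Q1 as [_ Q1].
      assert (Im z ^ 2 <= (2 * t) ^ 2) by (apply pow_incr; lra).
      apply Rmult_le_compat; try lra. 
      * assert (0 <= Cmod (f z)) by apply Cmod_ge_0. 
        assert (0 < Im z ^ 2) by (apply pow_lt; lra).
        apply Rnot_lt_le. intros Neg. nra.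
      * apply pow2_ge_0.
    + set (M := Rabs K * (2 * t) ^ 2) in *.
      assert (M0 : 0 <= M) by (unfold M; apply Rmult_le_pos; [lra | apply pow2_ge_0]).
      set (ih := (0, h) : C).
      assert (Eh : Cmod ih = Rabs h).
      { replace ih with (Ci * RtoC h)%C by (unfold ih; apply C_eq; simpl; ring).
        rewrite Cmod_mult, Cmod_Ci, Cmod_R. ring. }
      specialize (Hd2 ih). rewrite Eh in Hd2. specialize (Hd2 ltac:(lra)).
      replace ((sigma, t) + ih)%C with ((sigma, t + h) : C) in Hd2
        by (unfold ih; apply C_eq; simpl; ring).
      set (w1 := f (sigma, t + h)) in *. set (w0 := f (sigma, t)) in *.
      assert (B : Cmod (w1 - w0)%C <= 64 * M * Rabs h).
      { replace (w1 - w0)%C with ((w1 - w0 - ih * d) + ih * d)%C by ring.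
        eapply Rle_trans; [apply Cmod_triangle |]. rewrite Cmod_mult, Eh.
        pose proof (Rabs_pos h) as h0.
        assert (Rabs h * Cmod d <= Rabs h * (32 * M)).
        { apply Rmult_le_compat_l; [lra |]. replace (32 * M) with (4 * M / (1 / 8)) by field. exact Hd1. }
        replace (8 * M / (1 / 8) ^ 2) with (512 * M) in Hd2 by field.
        assert (512 * M * Rabs h ^ 2 <= 32 * M * Rabs h); [| lra].
        replace (512 * M * Rabs h ^ 2) with ((512 * Rabs h) * (M * Rabs h)) by ring.
        replace (32 * M * Rabs h) with (32 * (M * Rabs h)) by ring.
        apply Rmult_le_compat_r; [apply Rmult_le_pos; lra | lra]. }
      assert (B2 : Rabs (Cmod w1 - Cmod w0) <= Cmod (w1 - w0)%C).
      { apply Rabs_le. pose proof (Cmod_triangle_inv w1 w0). pose proof (Cmod_triangle_inv w0 w1).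
        rewrite (Cmod_minus_sym w0 w1) in H0. lra. }
      eapply Rle_trans; [exact B2 |]. eapply Rle_trans; [exact B |].
      apply Rmult_le_compat_r; [apply Rabs_pos |]. unfold M.
      replace (64 * (Rabs K * (2 * t) ^ 2)) with (256 * Rabs K * t ^ 2) by ring.
      pose proof (pow2_ge_0 t). lra.
Qed.

Section Moments.

(** From here on [F] stands for the modulus of zeta_2, of which only these growth and Lipschitz
    bounds are used. *)
Variables (F : R -> R -> R) (L : R).
Hypothesis HL : 0 < L.
Hypothesis HF0 : forall sigma t, 0 <= F sigma t.
Hypothesis HF : forall sigma t, 1 / 2 <= sigma <= 2 -> 2 <= t ->
  F sigma t <= L * t ^ 2 /\
  forall h, Rabs h <= 1 / 16 -> Rabs (F sigma (t + h) - F sigma t) <= L * t ^ 2 * Rabs h.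

Lemma moment_continuous sigma t n : 1 / 2 <= sigma <= 2 -> 2 <= t ->
  continuous (fun t => F sigma t ^ n) t.
Proof.
  intros Hs Ht.
  assert (H : continuous (F sigma) t).
  { apply continuous_eps. intros eps He.
    assert (P : 0 < L * t ^ 2) by (apply Rmult_lt_0_compat; [exact HL | apply pow_lt; lra]).
    exists (Rmin (1 / 16) (eps / (L * t ^ 2))). split.
    { apply Rmin_pos; [lra | apply Rdiv_lt_0_compat; lra]. }
    intros y Hy.
    pose proof (Rlt_le_trans _ _ _ Hy (Rmin_l _ _)) as H1.
    pose proof (Rlt_le_trans _ _ _ Hy (Rmin_r _ _)) as H2.
    destruct (HF sigma t Hs Ht) as [_ B]. specialize (B (y - t) ltac:(lra)).
    replace (t + (y - t)) with y in B by ring.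
    eapply Rle_lt_trans; [exact B |].
    apply (Rmult_lt_compat_l (L * t ^ 2)) in H2; [| exact P].
    replace (L * t ^ 2 * (eps / (L * t ^ 2))) with eps in H2 by (field; lra). exact H2. }
  apply (continuous_comp (F sigma) (fun x => x ^ n) t H).
  apply continuous_of_derive. eexists. auto_derive; auto.
Qed.

Lemma ex_RInt_moment sigma n a b : 1 / 2 <= sigma <= 2 -> 2 <= a -> a <= b ->
  ex_RInt (fun t => F sigma t ^ n) a b.
Proof.
  intros Hs Ha Hab. apply ex_RInt_cont; [exact Hab |].
  intros t Ht. apply moment_continuous; [exact Hs | lra].
Qed.

Lemma Rpower_ge_1 x y : 1 <= x -> 0 <= y -> 1 <= Rpower x y.
Proof.
  intros Hx Hy. rewrite <- (Rpower_O x) by lra. apply Rle_Rpower; lra.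
Qed.

Lemma Rpower_base_le x y a : 0 < x -> x <= y -> 0 <= a -> Rpower x a <= Rpower y a.
Proof. intros Hx Hxy Ha. apply Rle_Rpower_l; lra. Qed.

Lemma Lindelof_moments :
  (forall eps, 0 < eps -> bigO_strip F (fun t => Rpower t eps)) ->
  forall k : nat, (1 <= k)%nat -> forall eps, 0 < eps ->
    bigO_strip (fun sigma T => RInt (fun t => F sigma t ^ (2 * k)) 2 T)
      (fun T => Rpower T (1 + eps)).
Proof.
  intros H k Hk eps He.
  assert (Pk : 0 < INR (2 * k)) by (apply lt_0_INR; lia).
  (* This exponent becomes eps after raising to the power 2k. The bound is silent for t <= T0; there
     the polynomial growth gives the constant [B]. *)
  destruct (H (eps / INR (2 * k))) as (A & T0 & HA); [apply Rdiv_lt_0_compat; lra |].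
  set (T1 := Rmax T0 2 + 1).
  assert (HT0 : T0 < T1) by (unfold T1; pose proof (Rmax_l T0 2); lra).
  assert (HT2 : 2 < T1) by (unfold T1; pose proof (Rmax_r T0 2); lra).
  set (B := L * T1 ^ 2).
  assert (B0 : 0 < B) by (apply Rmult_lt_0_compat; [exact HL | apply pow_lt; lra]).
  set (D := B ^ (2 * k) + Rabs A ^ (2 * k)).
  assert (D1 : 0 <= B ^ (2 * k)) by (apply pow_le; lra).
  assert (D2 : 0 <= Rabs A ^ (2 * k)) by (apply pow_le, Rabs_pos).
  exists D, T1. intros T HT sigma Hs.
  pose proof (Rpower_ge_1 T eps ltac:(lra) ltac:(lra)) as PT.
  assert (Hb : forall t, 2 <= t <= T -> Rabs (F sigma t ^ (2 * k)) <= D * Rpower T eps).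
  { intros t Ht. rewrite Rabs_pos_eq by (apply pow_le, HF0).
    destruct (Rle_dec t T1) as [Q | Q].
    - apply Rle_trans with (B ^ (2 * k)).
      + apply pow_incr. split; [apply HF0 |].
        eapply Rle_trans; [apply (HF sigma t Hs); lra |].
        apply Rmult_le_compat_l; [lra | apply pow_incr; lra].
      + unfold D. nra.
    - apply Rle_trans with ((Rabs A * Rpower t (eps / INR (2 * k))) ^ (2 * k)).
      + apply pow_incr. split; [apply HF0 |].
        specialize (HA t ltac:(lra) sigma Hs). rewrite Rabs_pos_eq in HA by apply HF0.
        eapply Rle_trans; [exact HA |]. apply Rmult_le_compat_r; [apply Rlt_le, Rpower_pos | apply Rle_abs].
      + rewrite Rpow_mult_distr, <- (Rpower_pow _ (Rpower t _)), Rpower_mult by apply Rpower_pos.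
        replace (eps / INR (2 * k) * INR (2 * k)) with eps by (field; lra).
        assert (Rpower t eps <= Rpower T eps) by (apply Rpower_base_le; lra).
        pose proof (Rpower_pos t eps).
        apply Rle_trans with (Rabs A ^ (2 * k) * Rpower T eps).
        * apply Rmult_le_compat_l; lra.
        * apply Rmult_le_compat_r; [lra | unfold D; lra]. }
  pose proof (norm_RInt_le_const (V := R_NormedModule) (fun t => F sigma t ^ (2 * k)) 2 T
    (RInt (fun t => F sigma t ^ (2 * k)) 2 T) (D * Rpower T eps) ltac:(lra) Hb) as N.
  lapply N; [clear N; intro N |].
  - change (Rabs (RInt (fun t => F sigma t ^ (2 * k)) 2 T) <= (T - 2) * (D * Rpower T eps)) in N.
    eapply Rle_trans; [exact N |]. rewrite Rpower_plus, Rpower_1 by lra.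
    assert (0 <= D * Rpower T eps) by (apply Rmult_le_pos; [unfold D |]; lra). nra.
  - apply (RInt_correct (V := R_CompleteNormedModule)). apply ex_RInt_moment; lra.
Qed.

(* If [F sigma t = m], the Lipschitz bound keeps [F sigma] above [m / 2] on an interval of
   length [delta], a multiple of [m / t ^ 2]. *)
Lemma moment_lower_bound sigma t k : 1 / 2 <= sigma <= 2 -> 2 <= t ->
  let delta := F sigma t / (16 * L * t ^ 2) in
  0 <= delta <= 1 / 16 /\
  delta * (F sigma t / 2) ^ (2 * k) <= RInt (fun u => F sigma u ^ (2 * k)) 2 (t + delta).
Proof.
  intros Hs Ht delta. set (m := F sigma t) in *.
  assert (m0 : 0 <= m) by apply HF0.
  destruct (HF sigma t Hs Ht) as [Hm HLip]. fold m in Hm, HLip.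
  assert (Pt : 0 < L * t ^ 2) by (apply Rmult_lt_0_compat; [exact HL | apply pow_lt; lra]).
  (* So F drops by at most m / 16 on the interval, and m <= L t^2 places delta within the range 1/16
     of the Lipschitz bound. *)
  assert (Ed : L * t ^ 2 * delta = m / 16) by (unfold delta; field; nra).
  assert (Hd : 0 <= delta <= 1 / 16) by (split; nra).
  split; [exact Hd |].
  rewrite <- (RInt_Chasles (V := R_CompleteNormedModule) _ 2 t (t + delta));
    try (apply ex_RInt_moment; lra).
  unfold plus; simpl.
  assert (I1 : 0 <= RInt (fun u => F sigma u ^ (2 * k)) 2 t).
  { apply RInt_ge_0; [lra | apply ex_RInt_moment; lra |]. intros; apply pow_le, HF0. }
  assert (I2 : delta * (m / 2) ^ (2 * k) <= RInt (fun u => F sigma u ^ (2 * k)) t (t + delta)).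
  { replace (delta * (m / 2) ^ (2 * k)) with (RInt (fun _ => (m / 2) ^ (2 * k)) t (t + delta)).
    - apply RInt_le; [lra | apply ex_RInt_const | apply ex_RInt_moment; lra |].
      intros u Hu. apply pow_incr. split; [lra |].
      specialize (HLip (u - t)). rewrite Rabs_pos_eq in HLip by lra.
      specialize (HLip ltac:(lra)). replace (t + (u - t)) with u in HLip by ring.
      assert (L * t ^ 2 * (u - t) <= L * t ^ 2 * delta) by (apply Rmult_le_compat_l; lra).
      apply Rabs_le_between in HLip. lra.
    - rewrite RInt_const. unfold scal; simpl; unfold mult; simpl. ring. }
  simpl in I1, I2. lra.
Qed.

Lemma moments_Lindelof :
  (forall k : nat, (1 <= k)%nat -> forall eps, 0 < eps ->
    bigO_strip (fun sigma T => RInt (fun t => F sigma t ^ (2 * k)) 2 T)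
      (fun T => Rpower T (1 + eps))) ->
  forall eps, 0 < eps -> bigO_strip F (fun t => Rpower t eps).
Proof.
  intros H eps He.
  (* The target is m^(2k+1) << t^4, so k is taken with 4 / (2k + 1) <= eps. The moment hypothesis is
     used for this single k, with its exponent 1 + 1 = 2. *)
  destruct (INR_unbounded (2 / eps)) as [k0 Hk0].
  set (k := S k0).
  assert (Hk : 4 <= eps * INR (S (2 * k))).
  { unfold k. rewrite S_INR, mult_INR, (S_INR k0). simpl (INR 2).
    apply (Rmult_gt_compat_l eps) in Hk0; [| exact He].
    replace (eps * (2 / eps)) with 2 in Hk0 by (field; lra). nra. }
  destruct (H k ltac:(unfold k; lia) 1 Rlt_0_1) as (A & T0 & HA).
  (* 64 = 16 * 4: the 16 is the one in delta, and the 4 comes from t + delta <= 2t. *)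
  set (c := 64 * 2 ^ (2 * k) * L * Rabs A).
  assert (P2 : 0 < 2 ^ (2 * k)) by (apply pow_lt; lra).
  assert (c0 : 0 <= c) by 
    (unfold c; pose proof (Rabs_pos A); apply Rmult_le_pos; [apply Rmult_le_pos |]; lra).
  exists (c + 1), (Rmax T0 2). intros t Ht sigma Hs.
  pose proof (Rmax_l T0 2). pose proof (Rmax_r T0 2).
  rewrite Rabs_pos_eq by apply HF0.
  destruct (moment_lower_bound sigma t k Hs ltac:(lra)) as [Hd Hlow].
  set (m := F sigma t) in *. set (delta := m / (16 * L * t ^ 2)) in *.
  assert (m0 : 0 <= m) by apply HF0.
  specialize (HA (t + delta) ltac:(lra) sigma Hs).
  pose proof (Rle_trans _ _ _ (Rle_abs _) HA) as Hup.
  replace (1 + 1) with (INR 2) in Hup by (simpl; ring).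
  rewrite Rpower_pow in Hup by lra.
  assert (Pt2 : 0 < t ^ 2) by (apply pow_lt; lra).
  assert (Hup2 : A * (t + delta) ^ 2 <= 4 * Rabs A * t ^ 2).
  { replace (4 * Rabs A * t ^ 2) with (Rabs A * (2 * t) ^ 2) by ring.
    apply Rle_trans with (Rabs A * (t + delta) ^ 2).
    - apply Rmult_le_compat_r; [apply pow2_ge_0 | apply Rle_abs].
    - apply Rmult_le_compat_l; [apply Rabs_pos | apply pow_incr; lra]. }
  assert (Hm : m ^ S (2 * k) <= c * t ^ 4).
  { assert (E : m ^ S (2 * k) = 16 * L * t ^ 2 * 2 ^ (2 * k) * (delta * (m / 2) ^ (2 * k))).
    { unfold delta. rewrite <- tech_pow_Rmult. unfold Rdiv at 2. rewrite Rpow_mult_distr, pow_inv.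
      field. repeat split; apply Rgt_not_eq; lra. }
    rewrite E. unfold c.
    replace (64 * 2 ^ (2 * k) * L * Rabs A * t ^ 4)
      with (16 * L * t ^ 2 * 2 ^ (2 * k) * (4 * Rabs A * t ^ 2)) by ring.
    apply Rmult_le_compat_l.
    - apply Rmult_le_pos; [apply Rmult_le_pos |]; lra.
    - eapply Rle_trans; [exact Hlow |]. eapply Rle_trans; [exact Hup | exact Hup2]. }
  (* Instead of extracting a root, assume m exceeds (c + 1) t^eps and compare (2k+1)-st powers: the
     result exceeds c t^4. *)
  apply Rnot_lt_le. intros Hlt.
  assert (Hpow : ((c + 1) * Rpower t eps) ^ S (2 * k) <= m ^ S (2 * k)).
  { apply pow_incr. split; [| lra]. apply Rmult_le_pos; [lra | apply Rlt_le, Rpower_pos]. }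
  rewrite Rpow_mult_distr, <- (Rpower_pow _ (Rpower t eps)), Rpower_mult in Hpow by apply Rpower_pos.
  assert (Q1 : t ^ 4 <= Rpower t (eps * INR (S (2 * k)))).
  { rewrite <- Rpower_pow by lra. apply Rle_Rpower; [lra |]. simpl (INR 4). lra. }
  assert (Q2 : c + 1 <= (c + 1) ^ S (2 * k)).
  { rewrite <- tech_pow_Rmult. rewrite <- (Rmult_1_r (c + 1)) at 1.
    apply Rmult_le_compat_l; [lra | apply pow_R1_Rle; lra]. }
  assert (P4 : 0 < t ^ 4) by (apply pow_lt; lra).
  assert (Q3 : (c + 1) * t ^ 4 <= (c + 1) ^ S (2 * k) * Rpower t (eps * INR (S (2 * k)))).
  { apply Rmult_le_compat; lra. }
  lra.
Qed.

End Moments.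

Theorem theorem3 (v w alpha y1 y2 : R) (Z : C -> C)
  (hv : 0 < v) (hw : 0 < w)
  (halg : algebraic (v / w)) (hirr : irrational (v / w))
  (hy1 : 0 <= y1 < 1) (hy2 : 0 <= y2 < 1)
  (halpha : alpha = v * (1 - y1) + w * (1 - y2))
  (hZ : is_barnes_zeta2 alpha v w Z) :
  (forall eps : R, 0 < eps ->
     bigO_strip
       (fun sigma t => Cmod (Z (RtoC sigma + Ci * RtoC t)%C))
       (fun t => Rpower t eps))
  <->
  (forall k : nat, (1 <= k)%nat -> forall eps : R, 0 < eps ->
     bigO_strip
       (fun sigma T =>
          RInt (fun t => Cmod (Z (RtoC sigma + Ci * RtoC t)%C) ^ (2 * k)) 2 T)
       (fun T => Rpower T (1 + eps))).
Proof.
  destruct hZ as [Hmer Hser].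
  (* With y1, y2 < 1 every base alpha + v m + w n is positive, as real powers require. *)
  assert (Ha : 0 < alpha) by (rewrite halpha; nra).
  destruct (barnes_continuation_regular alpha v w Ha hv hw) as [K HK].
  assert (EZ : forall s, in_strip s -> Z s = barnes_continuation alpha v w s).
  { apply identity_on_strip; [exact Hmer | intros; apply HK; assumption |].
    intros s Hs H2. apply barnes_continuation_series; auto. }
  destruct (strip_regular_growth K _ HK) as (L & HL & HG).
  assert (Es : forall sigma t, (RtoC sigma + Ci * RtoC t)%C = (sigma, t)).
  { intros. apply C_eq; simpl; ring. }
  assert (HF : forall sigma t, 1 / 2 <= sigma <= 2 -> 2 <= t ->
    Cmod (Z (RtoC sigma + Ci * RtoC t)%C) <= L * t ^ 2 /\
    forall h, Rabs h <= 1 / 16 ->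
      Rabs (Cmod (Z (RtoC sigma + Ci * RtoC (t + h))%C) - Cmod (Z (RtoC sigma + Ci * RtoC t)%C))
        <= L * t ^ 2 * Rabs h).
  { intros sigma t Hs Ht. destruct (HG sigma t Hs Ht) as [G1 G2].
    rewrite Es, EZ by (unfold in_strip; simpl; lra). split; [exact G1 |].
    (* As t >= 2, the shifted point still has imaginary part above 1 and so lies in the strip. *)
    intros h Hh. pose proof Hh as Hh'. apply Rabs_le_between in Hh'.
    rewrite Es, EZ by (unfold in_strip; simpl; lra). apply G2, Hh. }
  split.
  - apply (Lindelof_moments _ L HL); [intros; apply Cmod_ge_0 | exact HF].
  - apply (moments_Lindelof _ L HL); [intros; apply Cmod_ge_0 | exact HF].
Qed.
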